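(* Let $X$ be a transitive graph with connectivity $1$ and let $G=\mathrm{Aut}(X)$. Let $n$ be the number of blocks of $X$ that a vertex of $X$ lies in (this number does not depend on the vertex). (i) If the automorphism group of some block of $X$ is not transitive (on the vertex set of that block), then $G$ is not simple. (ii) If the automorphism group of every block of $X$ is transitive (on the vertex set of the block) and generated by vertex stabilizers, then $G$ is simple, unless $n=2$ and any two blocks of $X$ are isomorphic, in which case $G$ has a normal simple subgroup of index $2$.
   Context: Graphs are simple and undirected and not assumed to be locally finite. A graph $X$ is transitive if $\mathrm{Aut}(X)$ acts transitively on its vertex set. A connected graph $X$ has connectivity $1$ if there is a vertex $x$ of $X$ such that $X\setminus x$ is not connected. The blocks of a graph $X$ with connectivity $1$ are the maximal connected subgraphs of $X$ that do not have connectivity $1$. The automorphism group of a block $B$ means the full automorphism group $\mathrm{Aut}(B)$ of the graph $B$; it is generated by vertex stabilizers if the stabilizers in $\mathrm{Aut}(B)$ of the vertices of $B$ together generate $\mathrm{Aut}(B)$. ''Simple'' is meant in the abstract group-theoretic sense. *)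

(* Defs.v *)
From HB Require Import structures.
From Stdlib Require Export Relation_Operators.
From mathcomp Require Export all_boot.
From mathcomp Require Export boolp classical_sets functions cardinality.

Set Implicit Arguments.
Unset Strict Implicit.
Unset Printing Implicit Defensive.

Local Open Scope classical_set_scope.
Local Open Scope group_scope.

Section Groups.
Variable G : groupType.
Implicit Types H K A : set G.

Definition subgroup H := group_closed [in H].

Definition normal_in K H :=
  [/\ subgroup K, K `<=` H & forall k h, K k -> H h -> K (k ^ h)].

(* Abstract simplicity of the subgroup H: only its own normal subgroups, not
   those of the ambient group G, are considered.  Simplicity of G itself is
   [simple [set: G]].  The trivial group is not simple. *)
Definition simple H :=
  [/\ subgroup H, H <> [set 1] &
      forall K, normal_in K H -> K = [set 1] \/ K = H].

Definition generated A : set G := smallest subgroup A.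

Definition lcosets H : set (set G) :=
  [set [set g * h | h in H] | g in [set: G]].

End Groups.

Record graph := Graph {
  vertex :> Type;
  adj : vertex -> vertex -> Prop;
  adj_sym : forall x y, adj x y -> adj y x;
  adj_irr : forall x, ~ adj x x
}.

Section Isomorphisms.

(* An isomorphism carries its inverse as data; since the inverse is determined
   by the map, two isomorphisms are equal as soon as their maps are. *)
Record iso (X Y : graph) := Iso {
  iso_fun :> X -> Y;
  iso_inv : Y -> X;
  iso_funK : cancel iso_fun iso_inv;
  iso_invK : cancel iso_inv iso_fun;
  iso_adj : forall x y, adj (iso_fun x) (iso_fun y) <-> adj x y
}.

Definition isomorphic (X Y : graph) := inhabited (iso X Y).

Lemma isoP X Y (f g : iso X Y) : f =1 g -> f = g.
Proof.
case: f g => [f f' fK f'K fA] [g g' gK g'K gA] /= /funext efg.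
move: g' gK g'K gA; rewrite -{}efg => g' gK g'K gA.
have efg' : f' = g' by apply: funext => y; rewrite -[in LHS](g'K y) fK.
move: gK g'K gA; rewrite -{}efg' => gK g'K gA.
by congr Iso; apply: Prop_irrelevance.
Qed.

End Isomorphisms.

Section Automorphisms.
Variable X : graph.

Definition aut := iso X X.

Definition aut_id : aut :=
  @Iso X X id id (fun _ => erefl) (fun _ => erefl) (fun _ _ => iff_refl _).

Definition aut_comp (f g : aut) : aut :=
  @Iso X X (iso_fun f \o iso_fun g) (iso_inv g \o iso_inv f)
    (can_comp (iso_funK f) (iso_funK g))
    (can_comp (iso_invK g) (iso_invK f))
    (fun x y => iff_trans (iso_adj f (g x) (g y)) (iso_adj g x y)).

Lemma aut_inv_adj (f : aut) x y : adj (iso_inv f x) (iso_inv f y) <-> adj x y.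
Proof. by rewrite -(iso_adj f) !iso_invK. Qed.

Definition aut_inv (f : aut) : aut :=
  @Iso X X (iso_inv f) (iso_fun f) (iso_invK f) (iso_funK f) (aut_inv_adj f).

Lemma aut_mulA : associative aut_comp.
Proof. by move=> f g h; apply: isoP. Qed.
Lemma aut_mul1 : left_id aut_id aut_comp.
Proof. by move=> f; apply: isoP. Qed.
Lemma aut_mulr1 : right_id aut_id aut_comp.
Proof. by move=> f; apply: isoP. Qed.
Lemma aut_mulV : left_inverse aut_id aut_inv aut_comp.
Proof. by move=> f; apply: isoP => x /=; rewrite iso_funK. Qed.
Lemma aut_mulrV : right_inverse aut_id aut_inv aut_comp.
Proof. by move=> f; apply: isoP => x /=; rewrite iso_invK. Qed.

HB.instance Definition _ := gen_eqMixin aut.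
HB.instance Definition _ := gen_choiceMixin aut.
HB.instance Definition _ := isGroup.Build aut
  aut_mulA aut_mul1 aut_mulr1 aut_mulV aut_mulrV.

Definition transitive_graph := forall x y : X, exists g : aut, g x = y.

Definition stabilizer (x : X) : set aut := [set g | g x = x].

Definition generated_by_stabilizers :=
  generated (\bigcup_(x in [set: X]) stabilizer x) = [set: aut].

End Automorphisms.

(* Subgraphs need not be induced. *)
Record subgraph (X : graph) := Subgraph {
  sub_vertex : set X;
  sub_edge : X -> X -> Prop;
  sub_edge_sym : forall x y, sub_edge x y -> sub_edge y x;
  sub_edge_adj : forall x y, sub_edge x y -> adj x y;
  sub_edge_vertex : forall x y, sub_edge x y -> sub_vertex x
}.

Definition graph_of_subgraph (X : graph) (H : subgraph X) : graph :=
  @Graph (set_type (sub_vertex H)) (fun x y => sub_edge H (val x) (val y))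
    (fun x y => @sub_edge_sym X H (val x) (val y))
    (fun x e => @adj_irr X (val x) (sub_edge_adj e)).
Coercion graph_of_subgraph : subgraph >-> graph.

Section Blocks.
Variable X : graph.

Definition subgraph_le (H K : subgraph X) :=
  sub_vertex H `<=` sub_vertex K /\
  forall x y, sub_edge H x y -> sub_edge K x y.

Definition delete_vertex (x : X) : subgraph X :=
  @Subgraph X [set y | y <> x] (fun y z => [/\ adj y z, y <> x & z <> x])
    (fun y z '(And3 e ny nz) => And3 (adj_sym e) nz ny)
    (fun y z '(And3 e _ _) => e)
    (fun y z '(And3 _ ny _) => ny).

End Blocks.

(* The empty graph counts as connected, so that a one-vertex graph does not
   have connectivity 1. *)
Definition connected (X : graph) :=
  forall x y : X, clos_refl_trans X (@adj X) x y.

Definition connectivity1 (X : graph) :=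
  connected X /\ exists x : X, ~ connected (delete_vertex x).

Definition is_block (X : graph) (B : subgraph X) :=
  [/\ connected B, ~ connectivity1 B &
      forall C : subgraph X,
        connected C -> ~ connectivity1 C -> subgraph_le B C -> C = B].

Definition blocks_at (X : graph) (x : X) : set (subgraph X) :=
  [set B | is_block B /\ sub_vertex B x].

(* Main.v *)
Require Import Defs.
From Stdlib Require Import Operators_Properties.
From mathcomp Require Import all_boot.
From mathcomp Require Import boolp classical_sets functions cardinality.

(** The blocks of a graph [X] of connectivity 1 and its vertices form a tree, in
    which a vertex is joined to the blocks that contain it: were there a cycle,
    two of its blocks would be joined by a walk avoiding their common vertex,
    and a cycle of [X] through that vertex would lie in both
    ([block_separation], [bedge_acyclic]).  The group [G] of automorphisms of
    [X] acts on this tree, preserving the two kinds of nodes, and a map of the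
    tree that agrees on every star with some element of [G] belongs to [G]
    ([bact_glue]).  The last fact is the independence property of Tits, and it
    rests on the observation that a locally bijective map of a tree is bijective
    ([tree_cover]).

    (i) A weight on the edges of a tree is the difference of a potential on its
    nodes ([potential]), so a [G]-invariant weight defines a homomorphism from
    [G] to a group with two elements, here through its kernel ([weight_kernel]).
    If a block is not transitive, its flags form several orbits, and the
    indicator of one of them makes this homomorphism nontrivial.  As a group
    with only two elements cannot be transitive on three vertices, the kernel is
    a proper nontrivial normal subgroup.

    (ii) Let [M] be generated by the stabilizers of the flags, that is, of the
    edges of the tree.  Tits's argument shows that a nontrivial subgroup [K]
    normalized by [M] contains [M] ([edge_fixator_sub_normal]).  First, [K]
    contains a translation [h] of the tree: an element that is not a translation
    fixes a node next to a moved one, and its product with a suitable conjugate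
    is a translation.  Next, some half-tree hanging off the axis of [h] has
    pairwise disjoint translates under the powers of [h], and by an infinite
    product every element supported on it is a commutator of [h] with an element
    of [M], hence in [K] ([wandering_supported]).  Conjugates of this half-tree
    contain all half-trees, and a flag stabilizer is generated by elements
    supported on half-trees ([supported_split]).

    For this, [M] has to be large.  When all blocks are transitive, every
    automorphism of a block, and every permutation of the blocks at a vertex
    that respects isomorphism types, extends to [X] ([star_extension]): the
    extension is built star by star, by recursion away from the given one.  When
    moreover the automorphism group of a block is generated by vertex
    stabilizers, which extend to elements of [M], the stabilizer of the block
    lies in [M] ([block_stabilizer]).  Thus [M] is transitive on the vertices,
    and it remains to compare it with the stabilizer of a vertex [x].  If an
    element of the latter moves a block [D] at [x], and there is a third block
    at [x], then a swap fixing this block corrects the element to one that fixes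
    [D], so [M] is all of [G] ([flag_group_full]).  If there are only two
    blocks at [x] and they are isomorphic, the swap exists, but the blocks can be
    colored alternatingly along the tree, and [M] preserves the colors while the
    swap does not ([swap_notin]); so [M] has index two. *)

Set Implicit Arguments.
Unset Strict Implicit.
Unset Printing Implicit Defensive.

Local Open Scope classical_set_scope.
Local Open Scope card_scope.
Local Open Scope group_scope.

(** * Trees *)

Lemma walk_ind (T : Type) (e : T -> T -> Prop) (P : T -> Prop) s t :
  (forall a b, e a b -> P a -> P b) ->
  clos_refl_trans T e s t -> P s -> P t.
Proof.
move=> step; elim=> [a b /step|//|a b c _ IH1 _ IH2 /IH1 /IH2]; exact.
Qed.

Lemma walk_sub (S T : Type) (f : S -> T) (e : S -> S -> Prop)
    (e' : T -> T -> Prop) s t :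
  (forall a b, e a b -> e' (f a) (f b)) ->
  clos_refl_trans S e s t -> clos_refl_trans T e' (f s) (f t).
Proof.
move=> ee'; elim=> [a b /ee'|a|a b c _ IH1 _]; first exact: rt_step.
  exact: rt_refl.
exact: rt_trans.
Qed.

Lemma walk_sym (T : Type) (e : T -> T -> Prop) s t :
  (forall a b, e a b -> e b a) ->
  clos_refl_trans T e s t -> clos_refl_trans T e t s.
Proof.
move=> esym; elim=> [a b /esym|a|a b c _ IH1 _ IH2]; first exact: rt_step.
  exact: rt_refl.
exact: rt_trans IH2 IH1.
Qed.

(** The nodes reached from [p] by walks that start with the edge from [p] to
    [q] and never backtrack.  In a tree this is the half-tree behind that
    edge. *)
Inductive behind (T : Type) (e : T -> T -> Prop) (p q : T) : T -> Prop :=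
| behind_end of e p q : behind e p q q
| behind_step r t of e p q & r <> p & behind e q r t : behind e p q t.

(** Acyclicity is stated for all closed walks without backtracking; such a walk
    contains a cycle, found by stripping first and last edges that coincide. *)
Record tree := Tree {
  node :> Type;
  edge : node -> node -> Prop;
  edge_sym : forall p q, edge p q -> edge q p;
  edge_connected : forall p q, clos_refl_trans node edge p q;
  edge_acyclic : forall p q, ~ behind edge p q p
}.

Section Half.
Variables (T : Type) (e : T -> T -> Prop).
Local Notation behind := (behind e).

Lemma behind_edge p q t : behind p q t -> e p q.
Proof. by case. Qed.

Lemma behind_next p q t :
  behind p q t -> t = q \/ exists2 r, r <> p & behind q r t.
Proof. by case=> [_|r u _ rp h]; [left | right; exists r]. Qed.

(** A walk without backtracking can be prolonged by any edge, except that the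
    edge may undo its last step. *)
Lemma behind_boundary p q t s :
  behind p q t -> e t s -> behind p q s \/ t = q /\ s = p.
Proof.
move=> h; elim: h s => {p q t} [p q epq|p q r t epq rp hqr IH] s ets.
  case: (pselect (s = p)) => [->|sp]; first by right.
  by left; apply: behind_step epq sp _; apply: behind_end.
case: (IH _ ets) => [hs|[-> ->]]; left; first exact: behind_step epq rp hs.
exact: behind_end.
Qed.

End Half.

Section HalfMap.
Variables (S T : Type) (e : S -> S -> Prop) (e' : T -> T -> Prop) (F : S -> T).
Hypothesis Fe : forall p q, e p q -> e' (F p) (F q).
Hypothesis Finj : forall p q r, e p q -> e p r -> F q = F r -> q = r.
Hypothesis esym : forall p q, e p q -> e q p.

(** Local injectivity is exactly what keeps the image of a walk free of
    backtracking. *)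
Lemma behind_map p q t : behind e p q t -> behind e' (F p) (F q) (F t).
Proof.
elim=> {p q t} [p q /Fe epq|p q r t epq rp hqr]; first exact: behind_end.
apply: behind_step; [exact: Fe|move=> Frp; apply: rp].
by apply: (Finj (behind_edge hqr) (esym epq)).
Qed.

End HalfMap.

Section TreeTheory.
Variable T : tree.
Implicit Types p q r s t u v o : T.
Local Notation e := (@edge T).
Local Notation behind := (behind e).
Local Notation tsym := (@edge_sym T).

Lemma behind_cover p q t : e p q -> behind p q t \/ behind q p t.
Proof.
move=> epq; pose P t := behind p q t \/ behind q p t.
apply: (@walk_ind T e P q t _ (edge_connected q t)); last by left; constructor.
move=> a b eab [] h.
  case: (behind_boundary h eab) => [|[_ ->]]; first by left.
  by right; constructor; apply: tsym.
case: (behind_boundary h eab) => [|[_ ->]]; first by right.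
by left; constructor.
Qed.

(** The walks from both ends of the edge to a common node would combine to a
    closed one: move the edge along the first walk until that is trivial. *)
Lemma behind_disjoint p q t : behind p q t -> behind q p t -> False.
Proof.
elim=> {p q t} [p q epq|p q r t epq rp hqr IH] h; first exact: edge_acyclic h.
apply: IH; apply: behind_step _ _ h; first exact: tsym (behind_edge hqr).
by move=> pr; apply: rp.
Qed.

Lemma behind_opp p q t : e p q -> (behind q p t <-> ~ behind p q t).
Proof.
move=> epq; split=> [h1 h2|h]; first exact: behind_disjoint h2 h1.
by case: (behind_cover t epq).
Qed.

Lemma behind_neighbors p q r t : behind p q t -> behind p r t -> q = r.
Proof.
move=> hq hr; apply: contrapT => nqr; apply: (behind_disjoint hq).
by apply: behind_step hr; [exact: tsym (behind_edge hq) | move=> rq; apply: nqr].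
Qed.

Lemma behind_ex p t : p <> t -> exists q, behind p q t.
Proof.
pose P t := p = t \/ exists q, behind p q t.
suff: P t by case.
apply: (@walk_ind T e P p t _ (edge_connected p t)); last by left.
move=> a b eab [pa|[q h]]; first by right; exists b; rewrite pa; constructor.
by case: (behind_boundary h eab) => [h'|[_ ->]]; [right; exists q | left].
Qed.

(** Walks behind the second edge start within the half-tree behind the first
    one, and could leave it only through [p]. *)
Lemma behind_nested p q r s :
  behind p q r -> ~ behind r s p -> behind r s `<=` behind p q.
Proof.
move=> hpr nrs t h; elim: h hpr nrs => {r s t} [r s ers|r s w t ers wr hsw IH] hr nrs.
  case: (behind_boundary hr ers) => // -[_ sp]; case: nrs.
  by rewrite sp in ers *; constructor.
apply: IH; last by move=> h; apply: nrs; apply: behind_step h.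
case: (behind_boundary hr ers) => // -[_ sp]; case: nrs.
by rewrite sp in ers *; constructor.
Qed.

(** ** Geodesics as lists *)

Fixpoint geodesic p q (w : seq T) : Prop :=
  e p q /\ if w is r :: w' then r <> p /\ geodesic q r w' else True.

Lemma geodesic_rcons p q w v :
  geodesic p q (rcons w v) <->
  [/\ geodesic p q w, e (last q w) v & v <> last p (belast q w)].
Proof.
elim: w p q => [|r w IH] p q /=.
  by split=> [[epq [vp [eqv _]]]|[[epq _] eqv vp]].
rewrite IH; split=> [[epq [rp [g ev nv]]]|[[epq [rp g]] ev nv]] //.
Qed.

Lemma behindP p q t : behind p q t <-> exists2 w, geodesic p q w & last q w = t.
Proof.
split=> [|[w]].
  elim=> {p q t} [p q epq|p q r t epq rp _ [w g wt]]; first by exists [::].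
  by exists (r :: w).
elim: w p q => [|r w IH] p q /= [epq]; first by move=> _ <-; constructor.
by move=> [rp g] wt; apply: behind_step epq rp _; apply: IH.
Qed.

Lemma geodesic_uniq p q w q' w' :
  geodesic p q w -> geodesic p q' w' -> last q w = last q' w' ->
  q = q' /\ w = w'.
Proof.
elim: w p q q' w' => [|r w IH] p q q' w' g g' ww'.
  have qq' : q = q'.
    apply: (@behind_neighbors p q q' q); apply/behindP; last by exists w'.
    by exists [::].
  split=> //; rewrite -{}qq' /= in g' ww'; case: w' g' ww' => //= r w' [_ [_ g']] ww'.
  by case: (@edge_acyclic T q r); apply/behindP; exists w'.
have qq' : q = q'.
  apply: (@behind_neighbors p q q' (last q (r :: w))); apply/behindP; last by exists w'.
  by exists (r :: w).
split=> //; rewrite -{q'}qq' in g' ww'; case: w' g' ww' => [|r' w'] /= g' ww'.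
  by case: (@edge_acyclic T q r); apply/behindP; exists w => //; case: g => _ [].
case: g => _ [_ g]; case: g' => _ [_ g'].
by case: (IH _ _ _ _ g g' ww') => -> ->.
Qed.

Definition rooted o (w : seq T) := if w is q :: w' then geodesic o q w' else True.

Lemma rooted_uniq o w w' :
  rooted o w -> rooted o w' -> last o w = last o w' -> w = w'.
Proof.
have nil q (u : seq T) : geodesic o q u -> o <> last q u.
  by move=> g ou; apply: (@edge_acyclic T o q); apply/behindP; exists u.
case: w => [|q w]; case: w' => [|q' w'] //= g g'; first by move/(nil _ _ g').
  by move/esym/(nil _ _ g).
by move/(geodesic_uniq g g')=> [-> ->].
Qed.

Lemma rooted_rcons o w u v : rooted o (rcons (rcons w u) v) <->
  [/\ rooted o (rcons w u), e u v & v <> last o w].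
Proof.
case: w => [|q w] /=; first by split=> [[? [? [? _]]]|[[? ?] ? ?]].
by rewrite geodesic_rcons last_rcons belast_rcons.
Qed.

Lemma rooted_edge o w t : rooted o w -> e (last o w) t ->
  rooted o (rcons w t) \/ exists w', w = rcons w' (last o w) /\ last o w' = t.
Proof.
case: (lastP w) => [|w' u] /=; first by left.
rewrite last_rcons => ro eut; case: (pselect (t = last o w')) => [->|nt].
  by right; exists w'.
by left; apply/rooted_rcons.
Qed.

Lemma rooted_ex o t : exists2 w, rooted o w & last o w = t.
Proof.
pose P t := exists2 w, rooted o w & last o w = t.
apply: (@walk_ind T e P o t _ (edge_connected o t)); last by exists [::].
move=> a b eab [w ro wa]; rewrite -wa in eab.
case: (rooted_edge ro eab) => [ro'|[w' [ww' w'b]]].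
  by exists (rcons w b) => //; rewrite last_rcons.
exists w' => //; move: ro; rewrite ww' => {ww' w'b eab wa}.
case: (lastP w') => // w2 u /rooted_rcons []; done.
Qed.

(** Definition by recursion away from a root [o]: along each edge, one end is
    the parent of the other, and the state of the child is computed from the
    state of the parent.  Consistency is the uniqueness of geodesics. *)
Lemma tree_recursion (S : Type) o (s0 : S) (step : T -> T -> S -> S) :
  exists (f : T -> S) (parent : T -> T -> Prop),
  [/\ f o = s0,
      forall s t, e s t -> parent s t \/ parent t s,
      forall s t, parent s t -> e s t /\ f t = step s t (f s) &
      forall P : T -> Prop, P o ->
        (forall s t, parent s t -> P s -> P t) -> forall t, P t].
Proof.
have [g gP] := @choice T (seq T) (fun t w => rooted o w /\ last o w = t)
  (fun t => let: ex_intro2 w rw wt := rooted_ex o t in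
            ex_intro _ w (conj rw wt)).
pose run := fix run p (w : seq T) st {struct w} :=
  if w is q :: w' then run q w' (step p q st) else st.
have run_rcons w v p st :
    run p (rcons w v) st = step (last p w) v (run p w st).
  by elim: w p st => //= q w IH p st; rewrite IH.
have guniq w t : rooted o w -> last o w = t -> g t = w.
  move=> rw wt; case: (gP t) => rg gt; apply: (rooted_uniq rg rw).
  by rewrite gt wt.
exists (fun t => run o (g t) s0), (fun s t => g t = rcons (g s) t); split.
- by rewrite (guniq [::]).
- move=> s t est; case: (gP s) => rs gs.
  rewrite -{1}gs in est; case: (rooted_edge rs est) => [r|[w' [ww' w't]]].
    by left; apply: guniq r _; rewrite last_rcons.
  right; rewrite gs in ww'; rewrite (guniq w' t) //.
  move: rs; rewrite {}ww'; case: (lastP w') => // w2 u /rooted_rcons []; done.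
- move=> s t gt; rewrite gt run_rcons; case: (gP s) => rs gs; rewrite gs; split=> //.
  case: (gP t); rewrite gt => rt _; move: rt rs gs; case: (lastP (g s)) => [|w u].
    by move=> /= [eot _] _ <-.
  by move=> /rooted_rcons [_ eut _] _; rewrite last_rcons => <-.
- move=> P P0 Pstep t.
  suff H : forall w, rooted o w -> P (last o w).
    by case: (gP t) => rt <-; apply: H.
  elim/last_ind => [//|w u IH ru].
  have rw : rooted o w.
    move: ru; case: (lastP w) => // w2 v /rooted_rcons []; done.
  rewrite last_rcons; apply: (Pstep (last o w)); last exact: IH.
  by rewrite (guniq w (last o w)) // (guniq (rcons w u)) // last_rcons.
Qed.

(** A weight on edges is the difference of a potential on nodes, as a tree has
    no cycle on which the weights could fail to sum to zero. *)
Lemma potential (w : T -> T -> bool) : (forall s t, w s t = w t s) ->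
  exists P : T -> bool, forall s t, e s t -> P s (+) P t = w s t.
Proof.
move=> wsym; have [[o _]|noT] := pselect (exists o : T, True); last first.
  by exists xpred0 => s; case: noT; exists s.
have [P [parent [_ par Pstep _]]] :=
  tree_recursion o false (fun s t b => b (+) w s t).
exists P => s t /par [] /Pstep [_ ->]; first by rewrite addKb.
by rewrite addbC addKb.
Qed.

(** ** Maps determined by their local behaviour *)

Definition star_eq (F mu : T -> T) t := forall s, e t s -> F s = mu s.

(** A locally bijective map of a tree is bijective: injective because images of
    non-backtracking walks do not backtrack, hence do not close up; surjective
    by connectedness. *)
Lemma tree_cover (F : T -> T) :
  (forall p q, e p q -> e (F p) (F q)) ->
  (forall p q r, e p q -> e p r -> F q = F r -> q = r) ->
  (forall p u, e (F p) u -> exists2 q, e p q & F q = u) ->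
  injective F /\ (forall p u, exists q, F q = u).
Proof.
move=> Fe Finj Fsurj; split=> [p t Fpt|p u].
  apply: contrapT => /behind_ex [q h].
  apply: (@edge_acyclic T (F p) (F q)); rewrite {2}Fpt.
  exact: (behind_map Fe Finj tsym h).
pose P u := exists q, F q = u.
apply: (@walk_ind T e P (F p) u _ (edge_connected _ _)); last by exists p.
by move=> a b eab [q Fq]; rewrite -Fq in eab; case: (Fsurj _ _ eab) => r _; exists r.
Qed.

(** [good t u mu] says that [mu] is an admissible map from the star of [t] to
    the star of [u].  If admissible maps can always be continued to adjacent
    stars, then each of them extends to the whole tree, by recursion away from
    the given star. *)
Lemma tree_extension (good : T -> T -> (T -> T) -> Prop) :
  (forall t u mu s, good t u mu -> e t s ->
     exists2 nu, good s (mu s) nu & nu t = u) ->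
  forall o o' mu0, good o o' mu0 ->
  exists F : T -> T, [/\ F o = o', star_eq F mu0 o &
    forall t, exists2 mu, good t (F t) mu & star_eq F mu t].
Proof.
move=> cont o o' mu0 good0.
have [M MP] := @choice (T * T * T * T) (T -> T)
  (fun x nu => let: (s, s', t, u) := x in
     (exists2 nu, good s s' nu & nu t = u) -> good s s' nu /\ nu t = u)
  (fun x => match x with (s, s', t, u) =>
     match pselect (exists2 nu, good s s' nu & nu t = u) with
     | left h => let: ex_intro2 nu a b := h in ex_intro _ nu (fun _ => conj a b)
     | right nh => ex_intro _ id (fun h => False_ind _ (nh h))
     end end).
have [f [parent [fo par fstep find]]] := tree_recursion o (o', mu0)
  (fun t s (st : T * (T -> T)) => (st.2 s, M (s, st.2 s, t, st.1))).
have fgood t : good t (f t).1 (f t).2.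
  move: t; apply: find => [|t s /fstep [ets ->] gt /=]; first by rewrite fo.
  by case: (MP (s, (f t).2 s, t, (f t).1) (cont _ _ _ _ gt ets)).
have fstar t : star_eq (fst \o f) (f t).2 t.
  move=> s /par [] /fstep [ets fs] /=; first by rewrite fs.
  rewrite fs /=.
  by case: (MP (t, (f s).2 t, s, (f s).1) (cont _ _ _ _ (fgood s) ets)) => _ ->.
exists (fst \o f); split=> [|s eos|t] /=; first by rewrite fo.
  by move: (fstar o s eos); rewrite /= fo.
by exists (f t).2; [apply: fgood | apply: fstar].
Qed.

End TreeTheory.

(** * Subgroups *)

Section Subgroups.
Variable G : groupType.
Implicit Types (H K : set G) (g h : G).

Lemma subgroupP H : subgroup H <->
  [/\ H 1, forall g h, H g -> H h -> H (g * h) & forall g, H g -> H g^-1].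
Proof.
split=> [sH|[H1 HM HV]].
  split=> [|g h Hg Hh|g Hg]; first by case: sH; rewrite in_setE.
    by have /set_mem := group_closedM sH (mem_set Hg) (mem_set Hh).
  by have /set_mem := group_closedV sH (mem_set Hg).
split; first exact: mem_set.
by move=> g h /set_mem Hg /set_mem Hh; apply/mem_set/HM => //; apply: HV.
Qed.

Lemma subgroup_generated (A : set G) : subgroup (generated A).
Proof.
apply/subgroupP; split=> [H [/subgroupP[]]|g h Ag Ah H sH|g Ag H sH] //.
  by case/subgroupP: (sH.1) => _ HM _; apply: HM; [apply: Ag | apply: Ah].
by case/subgroupP: (sH.1) => _ _ HV; apply: HV; apply: Ag.
Qed.

End Subgroups.

(** * Groups acting on trees with the independence property *)

Section TreeAction.
Variables (T : tree) (G : groupType) (act : G -> T -> T).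
Hypothesis act1 : forall t, act 1 t = t.
Hypothesis actM : forall g h t, act (g * h) t = act g (act h t).
Hypothesis act_edge : forall g p q, edge p q -> edge (act g p) (act g q).
Implicit Types (p q r s t u v : T) (g h k f : G).
Local Notation e := (@edge T).
Local Notation behind := (behind e).

Lemma actK g : cancel (act g) (act g^-1).
Proof. by move=> t; rewrite -actM mulVg act1. Qed.

Lemma actKV g : cancel (act g^-1) (act g).
Proof. by move=> t; rewrite -actM mulgV act1. Qed.

Lemma act_inj g : injective (act g).
Proof. exact: can_inj (actK g). Qed.

Lemma act_behind g p q t : behind p q t -> behind (act g p) (act g q) (act g t).
Proof.
apply: behind_map; [exact: act_edge | | exact: edge_sym].
by move=> ? ? ? _ _ /act_inj.
Qed.

Lemma act_behindV g p q t : behind (act g p) (act g q) t -> behind p q (act g^-1 t).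
Proof. by move/(act_behind g^-1); rewrite !actK. Qed.

(** ** Normal subgroups from invariant weights *)

(** An element changes the potential of an invariant weight at all nodes or at
    none, as it preserves the differences along edges; the kernel consists of
    the elements that do not change it.  The last clause serves to exhibit
    elements outside the kernel. *)
Lemma weight_kernel (w : T -> T -> bool) :
  (forall s t, w s t = w t s) -> (forall g s t, w (act g s) (act g t) = w s t) ->
  exists N : set G, [/\ normal_in N [set: G],
    forall g h, ~ N g -> ~ N h -> N (g * h) &
    forall g s t, N g -> e s t -> e (act g s) t -> w s t = w (act g s) t].
Proof.
move=> wsym winv; have [P Pw] := potential wsym.
have cst g s t : P (act g s) (+) P s = P (act g t) (+) P t.
  pose Q t := P (act g s) (+) P s = P (act g t) (+) P t.
  apply: (@walk_ind T e Q s t _ (edge_connected s t)) => // a b eab; rewrite /Q => ->.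
  move: (Pw _ _ eab) (Pw _ _ (act_edge g eab)); rewrite winv => <-.
  by case: (P a); case: (P b); case: (P (act g a)); case: (P (act g b)).
have NE g t : P (act g t) = P t -> forall s, P (act g s) = P s.
  move=> gt s; move: (cst g s t); rewrite gt addbb.
  by case: (P s); case: (P (act g s)).
pose N := [set g | forall t, P (act g t) = P t].
exists N; split=> [|g h|g s t Ng est egst]; last first.
- by rewrite -(Pw _ _ est) -(Pw _ _ egst) Ng.
- move=> Ng Nh; have [t ht] : exists t, P (act h t) <> P t.
    by apply/existsNP.
  have gt : P (act g (act h t)) <> P (act h t) by move/NE.
  suff : P (act (g * h) t) = P t by move/NE.
  rewrite actM; move: ht gt.
  by case: (P t); case: (P (act h t)); case: (P (act g (act h t))).
split=> // [|k h Nk _ t].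
  apply/subgroupP; split=> [t|g h Ng Nh t|g Ng t]; first by rewrite act1.
    by rewrite actM Ng Nh.
  by rewrite -[in RHS](actKV g t) Ng.
rewrite conjgE !actM; move: (cst h^-1 (act k (act h t)) (act h t)).
rewrite actK Nk => /(congr1 (addb^~ (P (act h t)))).
by rewrite !addbK.
Qed.

(** ** Fixators of half-trees *)

Hypothesis act_faithful : forall g h, act g =1 act h -> g = h.

(** The independence property, in a local form: a map that agrees on every
    star with some group element is itself given by a group element. *)
Hypothesis act_glue : forall F : T -> T,
  (forall t, exists2 g, F t = act g t & star_eq F (act g) t) ->
  exists g, act g =1 F.

(** The group acts without inversion; [color] tells the two kinds of nodes
    apart. *)
Variable color : T -> bool.
Hypothesis color_edge : forall p q, e p q -> color p = ~~ color q.
Hypothesis color_act : forall g p, color (act g p) = color p.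

Definition edge_fixator : set G :=
  \bigcup_(x in [set x : T * T | e x.1 x.2])
     [set g | act g x.1 = x.1 /\ act g x.2 = x.2].

Definition supported p q : set G := [set g | forall t, ~ behind p q t -> act g t = t].

Lemma glue_family (I : Type) (Y : I -> set T) (gs : I -> G) :
  (forall i j t, Y i t -> Y j t -> i = j) ->
  (forall i s t, Y i s -> e s t -> ~ Y i t ->
     act (gs i) s = s /\ act (gs i) t = t) ->
  exists f, (forall i t, Y i t -> act f t = act (gs i) t) /\
            (forall t, (forall i, ~ Y i t) -> act f t = t).
Proof.
move=> Ydisj Ybd.
pose F t := match pselect (exists i, Y i t) with
  | left h => act (gs (projT1 (cid h))) t | right _ => t end.
have FY i t : Y i t -> F t = act (gs i) t.
  rewrite /F; case: pselect => [h Yt|nh Yt]; last by case: nh; exists i.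
  by case: cid => j /= Yj; rewrite (Ydisj _ _ _ Yj Yt).
have Fn t : (forall i, ~ Y i t) -> F t = t.
  by rewrite /F; case: pselect => // -[i Yi] /(_ i).
suff /act_glue [f fF] : forall t, exists2 g, F t = act g t & star_eq F (act g) t.
  by exists f; split=> [i t /FY|t /Fn]; rewrite fF.
move=> t; have [[i Yi]|nY] := pselect (exists i, Y i t).
  exists (gs i) => [|s ets]; first exact: FY.
  have [Ys|nYs] := pselect (Y i s); first exact: FY.
  have [_ gs_s] := Ybd _ _ _ Yi ets nYs.
  rewrite gs_s; have [[j Yj]|nYj] := pselect (exists j, Y j s); last first.
    by apply: Fn => j Yj; apply: nYj; exists j.
  rewrite (FY _ _ Yj); case: (Ybd _ _ _ Yj (edge_sym ets)) => // Yjt.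
  by apply: nYs; rewrite (Ydisj _ _ _ Yi Yjt).
have nY' i : ~ Y i t by move=> Yi; apply: nY; exists i.
exists 1 => [|s ets]; first by rewrite act1 Fn.
rewrite act1; have [[j Yj]|nYj] := pselect (exists j, Y j s); last first.
  by apply: Fn => j Yj; apply: nYj; exists j.
by rewrite (FY _ _ Yj); case: (Ybd _ _ _ Yj (edge_sym ets)).
Qed.

Lemma supported_edge p q g : e p q -> supported p q g ->
  act g p = p /\ act g q = q.
Proof.
move=> epq sg; have gp : act g p = p by apply: sg; apply: edge_acyclic.
split=> //; have [h|h] := pselect (behind p q (act g q)); last exact: act_inj (sg _ h).
have epgq : e (act g q) p by rewrite -{1}gp; apply/act_edge/edge_sym.
by case: (behind_boundary h epgq) => [/edge_acyclic|[]].
Qed.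

(** By independence, the map that agrees with a given element on one side of a
    fixed edge and is the identity on the other is again an element; the
    quotient is supported on the other side. *)
Lemma supported_split (K : set G) : subgroup K ->
  (forall p q, e p q -> supported p q `<=` K) -> edge_fixator `<=` K.
Proof.
move=> /subgroupP [_ KM _] supK g [[p q] /= epq [gp gq]].
have [f [fY fn]] : exists f, (forall t, behind p q t -> act f t = act g t) /\
    (forall t, ~ behind p q t -> act f t = t).
  have [|i t u ht etu nu|f [fY fn]] :=
    @glue_family unit (fun _ => behind p q) (fun _ => g); first by move=> [] [].
    by case: (behind_boundary ht etu) => // -[-> ->].
  by exists f; split=> t h; [apply: (fY tt) | apply: fn].
rewrite -[g](mulVKg f); apply: KM.
  by apply: (supK _ _ epq) => t ht; apply: fn.
apply: (supK _ _ (edge_sym epq)) => t ht.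
have {ht} ht : behind p q t.
  by apply: contrapT => nh; apply: ht; apply/behind_opp.
by rewrite actM -(fY _ ht) actK.
Qed.

Section NormalSubgroup.
Variables M K : set G.
Hypothesis sgK : subgroup K.
Hypothesis sgM : subgroup M.
Hypothesis M_edge : edge_fixator `<=` M.
Hypothesis normK : forall k m, K k -> M m -> K (k ^ m).

Let KM g h : K g -> K h -> K (g * h). Proof. by case/subgroupP: sgK => _ + _; apply. Qed.
Let KV g : K g -> K g^-1. Proof. by case/subgroupP: sgK => _ _; apply. Qed.
Let M1 : M 1. Proof. by case/subgroupP: sgM. Qed.
Let MM g h : M g -> M h -> M (g * h). Proof. by case/subgroupP: sgM => _ + _; apply. Qed.
Let MV g : M g -> M g^-1. Proof. by case/subgroupP: sgM => _ _; apply. Qed.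
Let normKV k m : K k -> M m -> K (m * k * m^-1).
Proof. by move=> Kk /MV Mm; have := normK Kk Mm; rewrite conjgE invgK mulgA. Qed.

(** If the translates of a half-tree [Y] under the powers of [h] are pairwise
    disjoint, then an element [g] supported on [Y] is a commutator with [h]:
    let [f] act on the [n]-th translate as the conjugate of [g] by the [n]-th
    power of [h]; conjugating [f] by [h] shifts the translates by one, so the
    quotient of [f] by its conjugate is [g].  The set [S] absorbs all positive
    translates. *)
Lemma wandering_supported h p q (S : set T) : K h -> e p q ->
  (forall t, behind p q t -> ~ S t) ->
  (forall t, behind p q t -> S (act h t)) -> (forall t, S t -> S (act h t)) ->
  supported p q `<=` K.
Proof.
move=> Kh epq YS hY hS g sg.
have [gp gq] := supported_edge epq sg.
pose Y n := [set t | behind p q (act (h ^+ n)^-1 t)].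
pose gs n := h ^+ n * g * (h ^+ n)^-1.
have Y0 t : Y 0%N t <-> behind p q t by rewrite /Y /= expg0 invg1 act1.
have hnY n t : behind p q t -> S (act (h ^+ n.+1) t).
  move=> ht; elim: n => [|n IH]; first by rewrite expg1; apply: hY.
  by rewrite expgS actM; apply: hS.
have Ylt m n t : (m < n)%N -> Y m t -> Y n t -> False.
  move=> mn Ym Yn; apply: (YS _ Ym).
  have := hnY (n - m.+1)%N _ Yn; rewrite -actM subnSK //.
  have {2}-> : n = (m + (n - m))%N by rewrite subnKC // ltnW.
  by rewrite expgnDr invgM mulVKg.
have Ydisj m n t : Y m t -> Y n t -> m = n.
  move=> Ym Yn; case: (ltngtP m n) => // /Ylt lt; first by case: (lt _ Ym Yn).
  by case: (lt _ Yn Ym).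
have Ybd n s t : Y n s -> e s t -> ~ Y n t ->
    act (gs n) s = s /\ act (gs n) t = t.
  move=> Ys est Yt; have est' := act_edge (h ^+ n)^-1 est.
  case: (behind_boundary Ys est') => // -[sq tp].
  by rewrite /gs !actM sq tp gp gq -sq -tp !actKV.
have Yg n t : Y n t -> Y n (act (gs n) t).
  rewrite /Y /gs /= !actM actK => ht; apply: contrapT => nh.
  by have gt := act_inj (sg _ nh); apply: nh; rewrite gt.
have YS' n t : Y n (act h^-1 t) <-> Y n.+1 t.
  by rewrite /Y /= -actM -invgM expgS.
have [f [fY fn]] := glue_family Ydisj Ybd.
have Mf : M f.
  apply: M_edge; exists (p, q) => //=.
  have Yq : Y 0%N q by apply/Y0; constructor.
  have Yp : ~ Y 0%N p by move/Y0/edge_acyclic.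
  have [gsq gsp] := Ybd _ _ _ Yq (edge_sym epq) Yp.
  split; last by rewrite (fY _ _ Yq).
  have [[n Yn]|nY] := pselect (exists n, Y n p); last first.
    by apply: fn => n Yn; apply: nY; exists n.
  rewrite (fY _ _ Yn); case: (Ybd _ _ _ Yn epq) => // Ynq.
  by apply: Yp; rewrite (Ydisj _ _ _ Yq Ynq).
have -> : g = f * h * f^-1 * h^-1.
  suff fE : f = g * (h * f * h^-1) by rewrite {1}fE -!mulgA !(mulKg, mulVKg) mulgV mulg1.
  apply: act_faithful => t; rewrite !actM.
  have [[[|n] Yn]|nY] := pselect (exists n, Y n t).
  - rewrite (fY _ _ Yn) (fn (act h^-1 t)); last first.
      by move=> n /YS' /(Ydisj _ _ _ Yn).
    by rewrite actKV /gs expg0 invg1 mulg1 mul1g.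
  - rewrite (fY _ _ Yn) (fY n); last exact/YS'.
    have -> : act h (act (gs n) (act h^-1 t)) = act (gs n.+1) t.
      by rewrite -!actM /gs expgS invgM !mulgA.
    rewrite sg // => /Y0 /(Ydisj _ _ _ (Yg _ _ Yn)); done.
  - have nY' n : ~ Y n t by move=> Yn; apply: nY; exists n.
    rewrite !fn // ?actKV ?sg // => [/Y0/nY'//|n /YS' /nY'//].
by apply: KM (KV Kh); apply: normKV.
Qed.

(** ** Hyperbolic elements *)

(** The walk from [p] through [q] to the image of [p] continues without
    backtracking along the image of the edge, that is, [k] is a translation
    with this edge on its axis. *)
Definition hyperbolic k p q :=
  behind p q (act k p) /\ ~ behind (act k p) (act k q) p.

Lemma hyperbolic_behind k p q s : hyperbolic k p q ->
  ~ behind (act k p) (act k s) p ->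
  forall t, behind p s t -> behind p q (act k t).
Proof.
by move=> [kp _] ns t /(act_behind k); apply: behind_nested.
Qed.

(** Peel both ends off the geodesic from a node to its image as long as the
    element maps the first edge to the last one, reversed; either this ends with
    a walk that continues without backtracking, or it reaches a fixed node. *)
Lemma elliptic_or_hyperbolic k t : act k t <> t ->
  (exists p q, [/\ e p q, act k p = p & act k q <> q]) \/
  (exists p q, hyperbolic k p q).
Proof.
move=> kt; have [q0 /behindP [w0 g0 w0k]] := @behind_ex T t (act k t) (nesym kt).
have [n le_n] := ubnP (size w0).
elim: n t q0 w0 {kt} g0 w0k le_n => // n IH p q w g wk le_n.
case: (lastP w) g wk le_n => [|w' u].
  move=> [epq _] /= qk _; move: (color_edge epq).
  by rewrite qk color_act; case: (color p).
have rev v (x : seq T) : geodesic p q x -> last q x = v ->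
    behind v (last p (belast q x)) p.
  elim/last_ind: x v => [|x y IHx] v.
    by move=> [epq _] /= <-; constructor; apply: edge_sym.
  rewrite geodesic_rcons last_rcons belast_rcons /= => -[gx ev nv] <-.
  by apply: behind_step (IHx _ gx erefl); [apply: edge_sym | apply: nesym].
move=> g; rewrite last_rcons => uk le_n; subst u.
have h1 : behind (act k p) (last q w') p.
  by have := rev _ _ g (last_rcons _ _ _); rewrite belast_rcons.
have h2 : behind p q (act k p).
  by apply/behindP; exists (rcons w' (act k p)); rewrite ?last_rcons.
have [kq|kq] := pselect (act k q = last q w'); last first.
  by right; exists p, q; split=> // h; apply: kq; apply: behind_neighbors h h1.
move: g; rewrite geodesic_rcons => -[g _ np].
case: w' g np le_n kq {h1} => [|r w'] /= g np le_n kq.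
  by left; exists q, p; split=> //; case: g => /edge_sym.
case: g => _ [_ g]; apply: (IH q r w' g) => //.
by move: le_n; rewrite size_rcons !ltnS => /ltnW.
Qed.

(** The walk from [p] to the image of [p] continues without backtracking along
    its own reversed image under the conjugate of [a], and further along the
    image of the edge from [p] to [q] under the product: [a] and its conjugate
    move the edges at their fixed nodes that face each other. *)
Lemma elliptic_product a g p q : act a p = p -> act a q <> q -> e p q ->
  behind p q (act g p) -> behind (act g p) (act g q) p ->
  hyperbolic (g * a * g^-1 * a) p q.
Proof.
move=> ap aq epq hgp hp; pose b := g * a * g^-1.
have bgp : act b (act g p) = act g p by rewrite /b !actM actK ap.
(* An element [c] that fixes the image of [p] and moves the edge there that
   faces [p] carries [p] into another half-tree at that node, and this one lies
   behind the edge from [p] to [q]. *)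
have far c : act c (act g p) = act g p -> act c (act g q) <> act g q ->
    behind p q (act c p).
  move=> cgp cgq; have := act_behind c hp; rewrite cgp.
  by apply: behind_nested => // h; apply: cgq; apply: behind_neighbors h hp.
have bgq : act b (act g q) <> act g q by rewrite /b !actM actK => /act_inj.
have hb : behind p q (act b p) by apply: far.
rewrite /hyperbolic -/b !(actM b) ap; split=> // h.
apply: aq; apply: behind_neighbors (act_behindV h) _.
by apply: far; [rewrite -{1}bgp actK | move=> h1; apply: bgq; rewrite -{1}h1 actKV].
Qed.

(** Moving along the axis allows the base node to be of either color. *)
Lemma hyperbolic_next k p q : hyperbolic k p q -> exists r, hyperbolic k q r.
Proof.
move=> [kp nkq]; have epq := behind_edge kp.
case: (behind_next kp) => [kpq|[r rp hr]].
  by move: (color_edge epq); rewrite -kpq color_act; case: (color p).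
exists r; have eqr := behind_edge hr; split.
  case: (behind_boundary hr (act_edge k epq)) => // -[kpr kqq].
  by case: nkq; rewrite kpr kqq; apply: behind_step (behind_end (edge_sym epq)) => //;
     [exact: edge_sym | exact: nesym].
move=> hq; have hkq : behind (act k p) (act k q) q.
  by apply: behind_step hq; [exact: act_edge | move/act_inj].
case: (behind_boundary hkq (edge_sym epq)) => // -[_ pkp].
by move: kp; rewrite -pkp => /edge_acyclic.
Qed.

(** ** Normal subgroups contain all edge fixators *)

(** The nodes of one color play the role of blocks, those of the other color
    the role of vertices. *)
Hypothesis block_trans : forall D x y, ~~ color D -> e D x -> e D y ->
  exists2 m, M m & act m D = D /\ act m x = y.
Hypothesis block_deg : forall D x, ~~ color D -> e D x ->
  exists y z, [/\ e D y, e D z, y <> x, z <> x & y <> z].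
Hypothesis vertex_deg : forall x D, color x -> e x D ->
  exists2 F, e x F & F <> D.

Lemma vertex_trans x y : color x -> color y -> exists2 m, M m & act m x = y.
Proof.
move=> cx; pose P t := if color t then exists2 m, M m & act m x = t
  else forall s, e t s -> exists2 m, M m & act m x = s.
suff : P y by rewrite /P => + cy; rewrite cy.
apply: (@walk_ind T e P x y _ (edge_connected x y)); last first.
  by rewrite /P cx; exists 1.
move=> s t est; rewrite /P (color_edge est); case: (boolP (color t)) => /= ct.
  by move=> /(_ _ est).
move=> [m Mm mx] u etu.
have [n Mn [_ ns]] := block_trans ct (edge_sym est) etu.
by exists (n * m); [exact: MM | rewrite actM mx].
Qed.

(** Every edge is carried by [M] to one facing away from it, as
    [elliptic_product] requires: over the block on it if [p] is a vertex, and
    otherwise over another block at [q], within which the image is moved if it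
    happens to face the wrong way. *)
Lemma facing_translate p q : e p q ->
  exists2 g, M g & behind p q (act g p) /\ behind (act g p) (act g q) p.
Proof.
move=> epq; have [cp|cp] := boolP (color p).
  have cq : ~~ color q by rewrite -(color_edge epq).
  have [y [_ [eqy _ yp _ _]]] := block_deg cq (edge_sym epq).
  have [g Mg [gq gp]] := block_trans cq (edge_sym epq) eqy.
  exists g => //; rewrite gp gq; split.
    by apply: behind_step epq yp _; constructor.
  by apply: behind_step (nesym yp) _; [exact: edge_sym | constructor; exact: edge_sym].
have cq : color q by rewrite -[color q]negbK -(color_edge epq).
have [F eqF Fp] := vertex_deg cq (edge_sym epq).
have cF : ~~ color F by rewrite -(color_edge eqF).
have [z [_ [eFz _ zq _ _]]] := block_deg cF (edge_sym eqF).
have cz : color z by rewrite -[color z]negbK -(color_edge eFz).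
have [g Mg gq] := vertex_trans cq cz.
have egpz : e (act g p) z by rewrite -gq; apply: act_edge.
have [gpF|gpF] := pselect (act g p = F).
  have [m Mm [mF mz]] := block_trans cF eFz (edge_sym eqF).
  exists (m * g); first exact: MM.
  rewrite !actM gq gpF mF mz; split.
    by apply: behind_step epq Fp _; constructor.
  by apply: behind_step (nesym Fp) _; [exact: edge_sym | constructor; exact: edge_sym].
exists g => //; rewrite gq; split.
  apply: behind_step epq Fp _; apply: behind_step eqF zq _.
  by apply: behind_step eFz gpF _; constructor; exact: edge_sym.
apply: behind_step egpz (nesym gpF) _.
apply: behind_step (edge_sym eFz) (nesym zq) _.
by apply: behind_step (edge_sym eqF) (nesym Fp) _; constructor; exact: edge_sym.
Qed.

Lemma supported_conj p q m : M m -> supported p q `<=` K ->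
  supported (act m p) (act m q) `<=` K.
Proof.
move=> Mm sK g sg; have -> : g = m * (m^-1 * g * m) * m^-1.
  by rewrite !mulgA mulgV mul1g mulgK.
apply: normKV => //; apply: sK => t ht.
rewrite !actM sg ?actK // => /act_behindV; rewrite actK; exact: ht.
Qed.

Lemma supported_sub p q r s : behind p q `<=` behind r s ->
  supported p q `<=` supported r s.
Proof. by move=> sub g sg t ht; apply: sg => /sub. Qed.

(** The simplicity argument for the group generated by the edge fixators.  A
    nontrivial element of [K], if elliptic, yields a hyperbolic one; this makes
    some half-tree behind an edge leaving the axis wander, so that [K] contains
    all that is supported on it.  As the translates of that half-tree contain
    all half-trees, the splitting of edge fixators concludes. *)
Theorem edge_fixator_sub_normal k : K k -> k <> 1 -> edge_fixator `<=` K.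
Proof.
move=> Kk k1.
have [t kt] : exists t, act k t <> t.
  apply/existsNP => kt; apply: k1; apply: act_faithful => t.
  by rewrite kt act1.
have {k Kk k1 t kt} [h [Kh [p [q hyp]]]] : exists h, K h /\ exists p q, hyperbolic h p q.
  have [[p [q [epq kp kq]]]|hyp] := elliptic_or_hyperbolic kt; last by exists k.
  have [g Mg [gp gq]] := facing_translate epq.
  exists (g * k * g^-1 * k); split; first by apply: KM => //; apply: normKV.
  by exists p, q; apply: elliptic_product.
have {p q hyp} [D [q [cD hyp]]] : exists D q, ~~ color D /\ hyperbolic h D q.
  have [cp|cp] := boolP (color p); last by exists p, q.
  have [r hyp'] := hyperbolic_next hyp; exists q, r; split=> //.
  by rewrite -(color_edge (behind_edge hyp.1)).
have eDq := behind_edge hyp.1.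
have [s [eDs sK]] : exists s, e D s /\ supported D s `<=` K.
  have [y [z [eDy eDz yq zq yz]]] := block_deg cD eDq.
  (* At most one neighbor of [D] is mapped towards [D]. *)
  have [s [eDs sq hs]] : exists s,
      [/\ e D s, s <> q & ~ behind (act h D) (act h s) D].
    have [hy|] := pselect (behind (act h D) (act h y) D); last by exists y.
    exists z; split=> // hz; apply: yz; apply: (@act_inj h).
    exact: behind_neighbors hy hz.
  exists s; split=> //.
  apply: (@wandering_supported h D s (behind D q)) => //.
  - by move=> t hst hqt; apply: sq; apply: behind_neighbors hst hqt.
  - exact: hyperbolic_behind.
  - by apply: hyperbolic_behind => //; case: hyp.
have sDK z : e D z -> supported D z `<=` K.
  move=> eDz; have [m Mm [mD ms]] := block_trans cD eDs eDz.
  by rewrite -mD -ms; apply: supported_conj.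
have cs : color s by rewrite -[color s]negbK -(color_edge eDs).
have sK' E x : ~~ color E -> e E x -> supported E x `<=` K.
  move=> cE eEx; have [z [_ [eEz _ zx _ _]]] := block_deg cE eEx.
  have cz : color z by rewrite -[color z]negbK -(color_edge eEz).
  have [m Mm mz] := vertex_trans cs cz.
  have [mD|mD] := pselect (act m D = E).
    have [n Mn [nE nz]] := block_trans cE eEz eEx.
    rewrite -nE -nz -mD -mz -!actM.
    by apply: supported_conj sK; apply: MM.
  apply: subset_trans (supported_conj Mm sK).
  apply: supported_sub => t ht; rewrite mz; apply: behind_step (nesym mD) _.
    by rewrite -mz; apply: act_edge.
  by apply: behind_step (nesym zx) ht; exact: edge_sym.
apply: supported_split => // p r epr.
have [cp|cp] := boolP (color p); last exact: sK'.
have [F epF Fr] := vertex_deg cp epr.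
have cF : ~~ color F by rewrite -(color_edge epF).
apply: subset_trans (sK' F p cF (edge_sym epF)); apply: supported_sub => t.
by apply: behind_step; [exact: edge_sym | exact: nesym].
Qed.

End NormalSubgroup.
End TreeAction.

(** * Blocks *)

Definition avoid (T : Type) (e : T -> T -> Prop) z p q :=
  [/\ e p q, p <> z & q <> z].

Lemma avoid_sym (T : Type) (e : T -> T -> Prop) z p q :
  (forall a b, e a b -> e b a) -> avoid e z p q -> avoid e z q p.
Proof. by move=> es [/es epq pz qz]. Qed.

(** Connectedness before and after deletion of a vertex is stated with walks of
    the ambient graph, which passes to images, unions and larger subgraphs
    without transport between vertex types. *)
Definition nonseparable (X : graph) (B : subgraph X) :=
  (forall p q, sub_vertex B p -> sub_vertex B q ->
     clos_refl_trans X (sub_edge B) p q) /\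
  (forall z p q, sub_vertex B p -> sub_vertex B q -> p <> z -> q <> z ->
     clos_refl_trans X (avoid (sub_edge B) z) p q).

Lemma path_walk (V : eqType) (e : rel V) (R : V -> V -> Prop) (a : V) s :
  path e a s ->
  (forall u v, u \in a :: s -> v \in a :: s -> e u v -> R u v) ->
  forall b, b \in a :: s -> clos_refl_trans V R a b.
Proof.
elim: s a => [|c s IH] a /=.
  by move=> _ _ b; rewrite inE => /eqP ->; exact: rt_refl.
move=> /andP [eac pc] eR b; rewrite inE => /orP [/eqP ->|bs]; first exact: rt_refl.
have Rac : R a c by apply: eR => //; rewrite !in_cons eqxx ?orbT.
apply: rt_trans (rt_step _ _ _ _ Rac) _; apply: (IH c pc) => // u v us vs.
by apply: eR; rewrite in_cons ?us ?vs orbT.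
Qed.

Lemma walk_path (V : eqType) (R : V -> V -> Prop) (a b : V) : clos_refl_trans V R a b ->
  exists2 s, path (fun u v => `[<R u v>]) a s & last a s = b.
Proof.
elim=> {a b} [a b Rab|a|a b c _ [s ps sb] _ [t pt tc]].
- by exists [:: b] => //=; rewrite andbT; apply/asboolP.
- by exists [::].
- by exists (s ++ t); rewrite ?cat_path ?last_cat ?ps ?sb.
Qed.

Section Subgraphs.
Variable X : graph.
Implicit Types (B C D : subgraph X) (p q u v x y z : X).

Lemma subgraph_ext B C : (forall x, sub_vertex B x <-> sub_vertex C x) ->
  (forall x y, sub_edge B x y <-> sub_edge C x y) -> B = C.
Proof.
case: B C => [vB eB sB aB iB] [vC eC sC aC iC] /= vBC eBC.
have vE : vB = vC by apply/seteqP; split=> x /vBC.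
have eE : eB = eC by apply/funext => x; apply/funext => y; apply/propext.
move: sC aC iC; rewrite -{}vE -{}eE {vBC eBC} => sC aC iC.
by congr Subgraph; apply: Prop_irrelevance.
Qed.

Lemma sub_edge_vertices B x y : sub_edge B x y -> sub_vertex B x /\ sub_vertex B y.
Proof.
by move=> h; split; [apply: sub_edge_vertex h | apply: sub_edge_vertex (sub_edge_sym h)].
Qed.

Lemma walk_lift (T : Type) (A : set T) (e : T -> T -> Prop) (x y : set_type A) :
  (forall a b, e a b -> A a) -> clos_refl_trans T e (val x) (val y) ->
  clos_refl_trans (set_type A) (fun a b => e (val a) (val b)) x y.
Proof.
move=> eA w; pose P b := forall b' : set_type A, val b' = b ->
  clos_refl_trans (set_type A) (fun a b => e (val a) (val b)) x b'.
suff : P (val y) by apply.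
apply: (@walk_ind T e P _ _ _ w) => [a b eab Pa b' b'b|b /val_inj ->]; last first.
  exact: rt_refl.
apply: rt_trans (Pa (exist _ a (mem_set (eA _ _ eab))) erefl) _.
by apply: rt_step => /=; rewrite b'b.
Qed.

Lemma connected_subgraphP (Y : graph) (H : subgraph Y) : connected H <->
  forall p q : Y, sub_vertex H p -> sub_vertex H q ->
    clos_refl_trans Y (sub_edge H) p q.
Proof.
split=> [cH p q hp hq|cH x y].
  have := cH (exist _ p (mem_set hp)) (exist _ q (mem_set hq)).
  exact: (@walk_sub H Y val).
apply: walk_lift; first exact: sub_edge_vertex.
by apply: cH; apply: set_mem; apply: valP.
Qed.

Lemma nonseparableP B : connected B /\ ~ connectivity1 B <-> nonseparable B.
Proof.
split=> [[cB n1B]|[cB nsB]].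
  have cB' := (connected_subgraphP B).1 cB; split=> // z p q Bp Bq pz qz.
  have [Bz|nBz] := pselect (sub_vertex B z); last first.
    apply: (@walk_sub X X id) (cB' _ _ Bp Bq) => a b eab.
    by case: (sub_edge_vertices eab) => Ba Bb; split=> // E; apply: nBz; rewrite -E.
  pose z' : B := exist _ z (mem_set Bz).
  have cz : connected (delete_vertex z').
    by apply: contrapT => ncz; apply: n1B; split=> //; exists z'.
  have := (connected_subgraphP _).1 cz (exist _ p (mem_set Bp)) (exist _ q (mem_set Bq)).
  have ne r (Br : sub_vertex B r) : r <> z -> (exist _ r (mem_set Br) : B) <> z'.
    by move=> rz [].
  move=> /(_ (ne _ _ pz) (ne _ _ qz)); apply: (@walk_sub B X val) => a b [ab az bz].
  by split=> // E; [apply: az | apply: bz]; apply: val_inj.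
split=> [|[_ [z]]]; first exact/connected_subgraphP.
apply; apply/connected_subgraphP => p q pz qz.
have Bv (r : B) : sub_vertex B (val r) by apply: set_mem; apply: valP.
have nv (r : B) : r <> z -> val r <> val z by move=> rz /val_inj.
have := nsB (val z) _ _ (Bv p) (Bv q) (nv _ pz) (nv _ qz).
move=> /(walk_lift _) w.
apply: (@walk_sub B B id) (w _) => [a b [ab az bz]|a b [ab _ _]].
  by split=> //; move=> E; [apply: az | apply: bz]; rewrite E.
exact: sub_edge_vertex ab.
Qed.

Definition sub_union (F : set (subgraph X)) : subgraph X :=
  @Subgraph X (\bigcup_(C in F) sub_vertex C)
    (fun x y => exists2 C, F C & sub_edge C x y)
    (fun x y '(ex_intro2 C FC e) => ex_intro2 _ _ C FC (sub_edge_sym e))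
    (fun x y '(ex_intro2 C FC e) => sub_edge_adj e)
    (fun x y '(ex_intro2 C FC e) => ex_intro2 _ _ C FC (sub_edge_vertex e)).

Lemma sub_union_le F C : F C -> subgraph_le C (sub_union F).
Proof. by move=> FC; split=> [x Cx|x y Cxy]; exists C. Qed.

(** After deletion of one vertex, one of the two common vertices remains, and
    it is joined to all that is left of each member.  Hence two vertices of a
    nonseparable subgraph determine a largest one. *)
Lemma nonseparable_union (F : set (subgraph X)) u v : u <> v ->
  (forall C, F C -> [/\ nonseparable C, sub_vertex C u & sub_vertex C v]) ->
  nonseparable (sub_union F).
Proof.
move=> uv FP; pose U := sub_union F.
have conn p : sub_vertex U p -> clos_refl_trans X (sub_edge U) p u.
  move=> [C FC Cp]; have [[cC _] Cu _] := FP _ FC.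
  by apply: (@walk_sub X X id) (cC _ _ Cp Cu) => a b; apply: (sub_union_le FC).2.
have conn_avoid z w p : w = u \/ w = v -> sub_vertex U p -> p <> z -> w <> z ->
    clos_refl_trans X (avoid (sub_edge U) z) p w.
  move=> wuv [C FC Cp] pz wz; have [[_ nC] Cu Cv] := FP _ FC.
  have Cw : sub_vertex C w by case: wuv => ->.
  apply: (@walk_sub X X id) (nC _ _ _ Cp Cw pz wz) => a b [ab az bz].
  by split=> //; apply: (sub_union_le FC).2.
split=> [p q Up Uq|z p q Up Uq pz qz].
  by apply: rt_trans (conn _ Up) _; apply: walk_sym (conn _ Uq); apply: sub_edge_sym.
have [w wuv wz] : exists2 w, w = u \/ w = v & w <> z.
  have [uz|uz] := pselect (u = z); last by exists u => //; left.
  by exists v; [right | move=> vz; apply: uv; rewrite uz vz].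
apply: rt_trans (conn_avoid _ _ _ wuv Up pz wz) _.
apply: walk_sym (conn_avoid _ _ _ wuv Uq qz wz) => a b.
by apply: avoid_sym; apply: sub_edge_sym.
Qed.

Lemma is_blockP B : is_block B <-> nonseparable B /\
  (forall C, nonseparable C -> subgraph_le B C -> C = B).
Proof.
split=> [[cB nB maxB]|[/nonseparableP [cB nB] maxB]].
  split; first exact/nonseparableP.
  by move=> C /nonseparableP [cC nC]; apply: maxB.
by split=> // C cC nC; apply: maxB; apply/nonseparableP.
Qed.

Lemma block_ex C u v : nonseparable C -> sub_vertex C u -> sub_vertex C v ->
  u <> v -> exists2 B, is_block B & subgraph_le C B.
Proof.
move=> nC Cu Cv uv.
pose F := [set E | [/\ nonseparable E, sub_vertex E u & sub_vertex E v]].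
have FC : F C by split.
exists (sub_union F); last exact: sub_union_le.
apply/is_blockP; split; first by apply: nonseparable_union uv _.
move=> E nE [vE eE]; have FE : F E by split=> //; apply: vE; exists C.
by apply: subgraph_ext => [x|x y]; split=> [h|];
   [exists E | exact: vE | exists E | exact: eE].
Qed.

Lemma block_absorb B C u v : is_block B -> nonseparable C -> u <> v ->
  sub_vertex B u -> sub_vertex B v -> sub_vertex C u -> sub_vertex C v ->
  subgraph_le C B.
Proof.
move=> /is_blockP [nB maxB] nC uv Bu Bv Cu Cv; pose F := [set B; C].
have <- : sub_union F = B.
  apply: maxB; last by apply: sub_union_le; left.
  by apply: nonseparable_union uv _ => E [] ->.
by apply: sub_union_le; right.
Qed.

Lemma block_meet B C u v : is_block B -> is_block C -> u <> v ->
  sub_vertex B u -> sub_vertex B v -> sub_vertex C u -> sub_vertex C v -> B = C.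
Proof.
move=> bB bC uv Bu Bv Cu Cv; have [nB _] := (is_blockP B).1 bB.
have [_ maxC] := (is_blockP C).1 bC.
by apply: maxC nB _; apply: block_absorb uv _ _ _ _ => //; case/is_blockP: bC.
Qed.

(** ** Cycles are nonseparable *)

Local Notation V := ({classic X} : eqType).
Local Notation eb := (fun a b : V => `[<@adj X a b>]).

Definition cycle_edge (c : seq V) (x y : V) :=
  [/\ adj x y, x \in c, y \in c & y = next c x \/ x = next c y].

Lemma cycle_edge_sym c x y : cycle_edge c x y -> cycle_edge c y x.
Proof. by move=> [/adj_sym a xc yc /or_comm n]; split. Qed.

Definition cycle_graph (c : seq V) : subgraph X :=
  @Subgraph X [set x : V | x \in c] (cycle_edge c) (@cycle_edge_sym c)
    (fun x y '(And4 a _ _ _) => a) (fun x y '(And4 _ xc _ _) => xc).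

(** Deleting a vertex from a cycle leaves a path: rotate the cycle so that the
    vertex comes first. *)
Lemma nonseparable_cycle c : uniq c -> cycle eb c -> nonseparable (cycle_graph c).
Proof.
move=> uc cc.
have ceb (x y : V) : x \in c -> y \in c -> next c x == y -> cycle_edge c x y.
  move=> xc yc /eqP ny; split=> //; last by left.
  by have /asboolP := next_cycle cc xc; rewrite ny.
have rotP (x : V) : x \in c -> exists s : seq V, [/\ path (frel (next c)) x (rcons s x),
    uniq (x :: s) & c =i x :: s].
  move=> xc; have [i s rs] := rot_to xc; exists s; split.
  - by have := cycle_next uc; rewrite -(rot_cycle i) rs.
  - by rewrite -rs rot_uniq.
  - by move=> y; rewrite -rs mem_rot.
have around (x y : V) : x \in c -> y \in c -> clos_refl_trans V (cycle_edge c) x y.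
  move=> xc yc; have [s [ps us cs]] := rotP x xc; rewrite cs in yc.
  move: ps; rewrite rcons_path => /andP [ps _].
  by apply: path_walk ps _ y yc => u v; rewrite -!cs; apply: ceb.
split=> [p q|z p q] /=; first exact: around.
move=> pc qc pz qz.
have [zc|nzc] := boolP ((z : V) \in c); last first.
  apply: (@walk_sub X X id) (around p q pc qc) => a b eab.
  by case: (eab) => _ ac bc _; split=> // E; move: nzc; rewrite -E ?ac ?bc.
have [[|a s] [ps us cs]] := rotP z zc; rewrite !cs !in_cons in pc qc.
  by case/orP: pc => [/eqP/pz|].
have {us} zs : z \notin a :: s by case/andP: us.
move: ps; rewrite rcons_path /= => /andP [/andP [_ ps] _].
have from_a (b : V) : b \in a :: s -> clos_refl_trans V (avoid (cycle_edge c) z) a b.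
  move: b; apply: path_walk ps _ => u v us vs euv; split.
  - by apply: ceb => //; rewrite cs inE ?us ?vs orbT.
  - by move=> uz; rewrite -uz us in zs.
  - by move=> vz; rewrite -vz vs in zs.
have {}pc : (p : V) \in a :: s by case/orP: pc => // /eqP /pz.
have {}qc : (q : V) \in a :: s by case/orP: qc => // /eqP /qz.
apply: rt_trans (from_a _ qc); apply: walk_sym (from_a _ pc) => u v.
by apply: avoid_sym; apply: cycle_edge_sym.
Qed.

(** Were the two sides joined by a walk avoiding [x], a shortest connection
    between a neighbor of [x] in [B] and one in [C] would close up through [x]
    to a cycle, and this cycle would lie in both blocks. *)
Lemma block_separation x B C p q : is_block B -> is_block C ->
  sub_vertex B x -> sub_vertex C x -> sub_vertex B p -> sub_vertex C q ->
  p <> x -> q <> x -> clos_refl_trans X (avoid (@adj X) x) p q -> B = C.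
Proof.
move=> bB bC Bx Cx Bp Cq px qx pq.
have nbr D r : is_block D -> sub_vertex D x -> sub_vertex D r -> r <> x ->
    exists2 a, sub_edge D x a & clos_refl_trans X (avoid (@adj X) x) a r.
  move=> /is_blockP [[cD nD] _] Dx Dr rx.
  have [a xa] : exists a, sub_edge D x a.
    have := cD _ _ Dx Dr => /(clos_rt_rt1n _ _ _ _) w.
    by case: w rx => [//|a b xa _ _]; exists a.
  exists a => //; apply: (@walk_sub X X id) (nD x a r _ Dr _ rx).
  - by move=> u v [/sub_edge_adj uv ux vx].
  - by case: (sub_edge_vertices xa).
  - by move=> ax; apply: (@adj_irr X x); rewrite -{2}ax; apply: sub_edge_adj xa.
have [a xa ap] := nbr B p bB Bx Bp px.
have [b xb bq] := nbr C q bC Cx Cq qx.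
have ab : clos_refl_trans X (avoid (@adj X) x) a b.
  apply: rt_trans ap (rt_trans _ _ _ _ _ pq _); apply: walk_sym bq => u v.
  by apply: avoid_sym; apply: adj_sym.
have ne D r : sub_edge D x r -> r <> x.
  by move=> /sub_edge_adj xr rx; apply: (@adj_irr X x); rewrite -{2}rx.
have ax := ne _ _ xa; have bx := ne _ _ xb.
have [s0 ps0] := @walk_path V _ _ _ ab.
case: (shortenP ps0) => s ps us _ sb {s0 ps0}.
have xs : (x : V) \notin ((a : V) :: s : seq V).
  rewrite inE negb_or; apply/andP; split; first by apply/eqP/nesym.
  elim: s (a) ps {us sb} => [//|c s IH] a' /= /andP [/asboolP [_ _ cx] ps].
  by rewrite inE negb_or (IH _ ps) andbT; apply/eqP/nesym.
pose c : seq V := x :: a :: s.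
have nc : nonseparable (cycle_graph c).
  apply: nonseparable_cycle; first by rewrite /c cons_uniq xs.
  rewrite /c /= rcons_path -/(last _ _); apply/and3P; split.
  - by apply/asboolP; apply: sub_edge_adj xa.
  - by apply: sub_path ps => u v /asboolP [uv _ _]; apply/asboolP.
  - by apply/asboolP/adj_sym; rewrite sb; apply: sub_edge_adj xb.
have cx : sub_vertex (cycle_graph c) x by rewrite /= /mkset inE eqxx.
have ca : sub_vertex (cycle_graph c) a by rewrite /= /mkset !inE eqxx orbT.
have cb : sub_vertex (cycle_graph c) b by rewrite /= /mkset inE -sb mem_last orbT.
have [_ Ba] := sub_edge_vertices xa; have [_ Cb] := sub_edge_vertices xb.
have leB := block_absorb bB nc ax Ba Bx ca cx.
by apply: (block_meet bB bC bx (leB.1 _ cb) Bx Cb Cx).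
Qed.

End Subgraphs.

(** * The block-cutvertex tree *)

Section Isomorphic.
Variables X Y Z : graph.

Definition iso_comp (f : iso Y Z) (g : iso X Y) : iso X Z :=
  @Iso X Z (iso_fun f \o iso_fun g) (iso_inv g \o iso_inv f)
    (can_comp (iso_funK f) (iso_funK g)) (can_comp (iso_invK g) (iso_invK f))
    (fun x y => iff_trans (iso_adj f (g x) (g y)) (iso_adj g x y)).

Lemma iso_inv_adj (f : iso X Y) x y : adj (iso_inv f x) (iso_inv f y) <-> adj x y.
Proof. by rewrite -(iso_adj f) !iso_invK. Qed.

Definition iso_sym (f : iso X Y) : iso Y X :=
  Iso (iso_invK f) (iso_funK f) (iso_inv_adj f).

End Isomorphic.

Lemma isomorphic_sym X Y : isomorphic X Y -> isomorphic Y X.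
Proof. by case=> f; split; apply: iso_sym. Qed.

Lemma isomorphic_trans Y X Z : isomorphic X Y -> isomorphic Y Z -> isomorphic X Z.
Proof. by case=> f [g]; split; apply: iso_comp g f. Qed.

Definition subv (X : graph) (B : subgraph X) x (Bx : sub_vertex B x) : B :=
  exist (fun y => y \in sub_vertex B) x (mem_set Bx).

Lemma subv_val (X : graph) (B : subgraph X) (x : B) : sub_vertex B (val x).
Proof. by apply: set_mem; apply: valP. Qed.

Section SubIso.
Variables (X : graph) (B C : subgraph X) (f f' : X -> X).
Hypothesis fBC : forall x, sub_vertex B x -> sub_vertex C (f x).
Hypothesis fCB : forall x, sub_vertex C x -> sub_vertex B (f' x).
Hypothesis fK : forall x, sub_vertex B x -> f' (f x) = x.
Hypothesis f'K : forall x, sub_vertex C x -> f (f' x) = x.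
Hypothesis fe : forall x y, sub_vertex B x -> sub_vertex B y ->
  (sub_edge C (f x) (f y) <-> sub_edge B x y).

Lemma subgraph_iso : exists th : iso B C, forall x, val (th x) = f (val x).
Proof.
pose th (x : B) : C := subv (fBC (subv_val x)).
pose th' (x : C) : B := subv (fCB (subv_val x)).
have thK : cancel th th' by move=> x; apply: val_inj; apply: fK (subv_val x).
have th'K : cancel th' th by move=> x; apply: val_inj; apply: f'K (subv_val x).
have tha x y : adj (th x) (th y) <-> adj x y.
  by apply: fe; apply: subv_val.
by exists (Iso thK th'K tha).
Qed.

End SubIso.

Definition block (X : graph) := {B : subgraph X | is_block B}.

Lemma block_ext X (D E : block X) : sval D = sval E -> D = E.
Proof.
case: D E => D bD [E bE] /= DE; case: E / DE bE => bE.
by congr exist; apply: Prop_irrelevance.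
Qed.

(** ** Blocks under automorphisms *)

Section Image.
Variable X : graph.
Implicit Types (g h : aut X) (B C : subgraph X).

Definition image_graph g B : subgraph X :=
  @Subgraph X [set x | sub_vertex B (iso_inv g x)]
    (fun x y => sub_edge B (iso_inv g x) (iso_inv g y))
    (fun x y e => sub_edge_sym e)
    (fun x y e => (aut_inv_adj g x y).1 (sub_edge_adj e))
    (fun x y e => sub_edge_vertex e).

Lemma image_graphM g h B : image_graph (g * h) B = image_graph g (image_graph h B).
Proof. exact: subgraph_ext. Qed.

Lemma image_graph1 B : image_graph 1 B = B.
Proof. exact: subgraph_ext. Qed.

Lemma image_graphK g B : image_graph g^-1 (image_graph g B) = B.
Proof. by rewrite -image_graphM mulVg image_graph1. Qed.

Lemma image_graph_le g B C :
  subgraph_le B C -> subgraph_le (image_graph g B) (image_graph g C).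
Proof. by move=> [vBC eBC]; split=> [x /vBC|x y /eBC]. Qed.

Lemma image_nonseparable g B : nonseparable B -> nonseparable (image_graph g B).
Proof.
move=> [cB nB]; split=> [p q Bp Bq|z p q Bp Bq pz qz].
  rewrite -(iso_invK g p) -(iso_invK g q).
  by apply: (walk_sub _ (cB _ _ Bp Bq)) => a b; rewrite /= !iso_funK.
rewrite -(iso_invK g p) -(iso_invK g q).
have inv_neq r : r <> z -> iso_inv g r <> iso_inv g z.
  by move=> rz /(can_inj (iso_invK g)).
apply: (walk_sub _ (nB (iso_inv g z) _ _ Bp Bq (inv_neq _ pz) (inv_neq _ qz))).
move=> a b [eab az bz]; split; first by rewrite /= !iso_funK.
- by move=> E; apply: az; rewrite -E iso_funK.
- by move=> E; apply: bz; rewrite -E iso_funK.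
Qed.

Lemma image_block g B : is_block B -> is_block (image_graph g B).
Proof.
move=> /is_blockP [nB maxB]; apply/is_blockP; split; first exact: image_nonseparable.
move=> C nC /(image_graph_le g^-1); rewrite image_graphK => le.
by rewrite -(maxB _ (image_nonseparable g^-1 nC) le) -image_graphM mulgV image_graph1.
Qed.

Lemma image_iso g B : exists th : iso B (image_graph g B),
  forall x, val (th x) = g (val x).
Proof.
apply: (@subgraph_iso _ _ _ g (iso_inv g)) => [x|x|x _|x _|x y _ _] //=.
- by rewrite /mkset iso_funK.
- by rewrite iso_funK.
- by rewrite iso_invK.
- by rewrite !iso_funK.
Qed.

Definition image_of_block g (D : block X) : block X :=
  exist _ (image_graph g (sval D)) (image_block g (svalP D)).

Lemma blocks_at_card g x : blocks_at (g x) #= blocks_at x.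
Proof.
have <- : [set image_graph g B | B in blocks_at x] = blocks_at (g x).
  apply/seteqP; split=> [_ [B [bB Bx] <-]|B [bB Bgx]].
    by split; [apply: image_block | rewrite /= /mkset iso_funK].
  exists (image_graph g^-1 B); last by rewrite -image_graphM mulgV image_graph1.
  by split=> //; apply: image_block.
apply: inj_card_eq => B C _ _ /(congr1 (image_graph g^-1)).
by rewrite !image_graphK.
Qed.


End Image.

(** ** The tree *)

Section BlockTree.
Variable X : graph.
Hypothesis h1 : connectivity1 X.
Implicit Types (x y z u v : X) (D E F : block X).

Definition bnode := (X + block X)%type.
Implicit Types (p q r s t : bnode).

Definition bedge p q : Prop :=
  match p, q with
  | inl x, inr D | inr D, inl x => sub_vertex (sval D) x
  | _, _ => False
  end.

Lemma bedge_sym p q : bedge p q -> bedge q p.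
Proof. by case: p; case: q. Qed.

Lemma cut_vertex_ex : exists x u v, [/\ u <> x, v <> x &
  ~ clos_refl_trans X (avoid (@adj X) x) u v].
Proof.
case: h1 => _ [x nc]; apply: contrapT => h; apply: nc.
apply/connected_subgraphP => u v ux vx; apply: contrapT => nuv; apply: h.
by exists x, u, v.
Qed.

Lemma neighbor_ex x : exists y, adj x y.
Proof.
have [y yx] : exists y, y <> x.
  have [c [u [v [uc _ _]]]] := cut_vertex_ex.
  have [cx|cx] := pselect (c = x); last by exists c.
  by exists u; rewrite -cx.
have := clos_rt_rt1n _ _ _ _ (h1.1 x y) => w.
by case: w yx => [//|a b xa _ _]; exists a.
Qed.

Lemma edge_block x y : adj x y -> exists D, sub_edge (sval D) x y.
Proof.
move=> xy; pose c : seq ({classic X} : eqType) := [:: x; y].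
have ne : x <> y by move=> E; apply: (@adj_irr X x); rewrite {2}E.
have xc : (x : {classic X}) \in c by rewrite mem_head.
have yc : (y : {classic X}) \in c by rewrite in_cons mem_head orbT.
have nc : nonseparable (cycle_graph c).
  apply: nonseparable_cycle; first by rewrite /= inE andbT; apply/eqP.
  by rewrite /= andbT; apply/andP; split; apply/asboolP => //; apply: adj_sym.
have [B bB [_ eB]] := block_ex nc xc yc ne.
by exists (exist _ B bB); apply: eB; split=> //; left; rewrite /= eqxx.
Qed.

Lemma block_two D : exists x y,
  [/\ sub_vertex (sval D) x, sub_vertex (sval D) y & x <> y].
Proof.
apply: contrapT => no2.
have no_edge x y : ~ sub_edge (sval D) x y.
  move=> exy; apply: no2; exists x, y; case: (sub_edge_vertices exy) => Dx Dy.
  split=> // E; apply: (@adj_irr X x); rewrite {2}E; exact: sub_edge_adj exy.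
have [x Dx] : exists x, forall z, sub_vertex (sval D) z -> z = x.
  have [[x Dx]|nD] := pselect (exists x, sub_vertex (sval D) x); last first.
    have [x _] := cut_vertex_ex; exists x => z Dz; by case: nD; exists z.
  by exists x => z Dz; apply: contrapT => zx; apply: no2; exists z, x.
have [y xy] := neighbor_ex x; have [E Exy] := edge_block xy.
have [Ex Ey] := sub_edge_vertices Exy.
have le : subgraph_le (sval D) (sval E).
  by split=> [z /Dx ->|a b /no_edge].
have [_ maxD] := (is_blockP _).1 (svalP D).
have [nE _] := (is_blockP _).1 (svalP E).
by apply: (no_edge x y); rewrite -(maxD _ nE le).
Qed.

Lemma bnode_connected p q : clos_refl_trans bnode bedge p q.
Proof.
have adj_walk x y : adj x y -> clos_refl_trans bnode bedge (inl x) (inl y).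
  move=> /edge_block [D /sub_edge_vertices [Dx Dy]].
  by apply: (@rt_trans _ _ _ (inr D)); apply: rt_step.
have vwalk x y : clos_refl_trans bnode bedge (inl x) (inl y).
  elim: (h1.1 x y) => [a b|a|a b c _ w1 _ w2]; first exact: adj_walk.
    exact: rt_refl.
  exact: rt_trans w1 w2.
have to_vertex p' : exists x, clos_refl_trans bnode bedge p' (inl x).
  case: p' => [x|D]; first by exists x; apply: rt_refl.
  by have [x [_ [Dx _ _]]] := block_two D; exists x; apply: rt_step.
have [x px] := to_vertex p; have [y qy] := to_vertex q.
apply: rt_trans px _; apply: rt_trans (vwalk x y) _.
by apply: walk_sym qy; apply: bedge_sym.
Qed.

(** The vertices other than [x] on the side of [D] after deletion of [x]. *)
Definition branch x D z := z <> x /\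
  exists2 y, sub_vertex (sval D) y /\ y <> x &
             clos_refl_trans X (avoid (@adj X) x) y z.

Lemma blocks_eq x y D E : x <> y -> sub_vertex (sval D) x -> sub_vertex (sval D) y ->
  sub_vertex (sval E) x -> sub_vertex (sval E) y -> D = E.
Proof.
move=> xy Dx Dy Ex Ey.
by apply: block_ext; apply: block_meet xy _ _ _ _ => //; apply: svalP.
Qed.

(** Branches are nested along a walk in the tree: otherwise [x] would lie in
    the branch at [y] through [E], and [D] and [E] would not be separated at
    [y]. *)
Lemma branch_step x y D E z : x <> y -> sub_vertex (sval D) x ->
  sub_vertex (sval D) y -> sub_vertex (sval E) y -> E <> D ->
  branch y E z -> branch x D z.
Proof.
move=> xy Dx Dy Ey ED [zy [w [Ew wy] wz]].
have not_x u : clos_refl_trans X (avoid (@adj X) y) w u -> u <> x.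
  move=> wu ux; apply: ED; apply: block_ext; rewrite ux in wu.
  exact: (block_separation (svalP E) (svalP D) Ey Dy Ew Dx wy xy wu).
have wz' : clos_refl_trans X (avoid (@adj X) x) w z.
  pose P u := clos_refl_trans X (avoid (@adj X) y) w u /\
              clos_refl_trans X (avoid (@adj X) x) w u.
  suff : P z by case.
  apply: (@walk_ind _ _ P _ _ _ wz); last by split; apply: rt_refl.
  move=> a b eab [wa wa']; have wb := rt_trans _ _ _ _ _ wa (rt_step _ _ _ _ eab).
  split=> //; apply: rt_trans wa' (rt_step _ _ _ _ _).
  by case: eab => ab _ _; split=> //; apply: not_x.
have Ex : ~ sub_vertex (sval E) x by move=> Ex; apply: ED; apply: (blocks_eq xy).
split; first exact: not_x.
exists y; first by split=> //; apply: nesym.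
apply: rt_trans _ wz'.
have [[cE _] _] := (is_blockP _).1 (svalP E).
apply: (@walk_sub X X id) (cE _ _ Ey Ew) => a b eab.
have [Ea Eb] := sub_edge_vertices eab.
by split; [apply: sub_edge_adj eab | move=> E'; apply: Ex; rewrite -E' ..].
Qed.

Lemma behind_branch p q t : behind bedge p q t ->
  match p, q, t with
  | inl x, inr D, inl z => branch x D z
  | inr D, inl y, inl z => forall x, sub_vertex (sval D) x -> x <> y -> branch x D z
  | _, _, _ => True
  end.
Proof.
elim=> {p q t} [[x|D] [y|E] //= Dy x Dx xy|].
  by split; [exact: nesym | exists y; [split=> //; exact: nesym | exact: rt_refl]].
move=> [x|D] [y|E] [z|F] [w|H] //= pq rp hqr; have //= qr := behind_edge hqr.
- by move=> br; apply: br => // xz; apply: rp; rewrite xz.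
- move=> br x Dx xy; apply: branch_step xy Dx pq qr _ br.
  by move=> FD; apply: rp; rewrite FD.
Qed.

(** A closed walk starting at a block [D] passes through a vertex [y] of [D]
    first, and the half-tree behind its next edge contains [D], hence also [y]. *)
Lemma bedge_acyclic p q : ~ behind bedge p q p.
Proof.
have vertex_acyclic x D : ~ behind bedge (inl x) (inr D) (inl x).
  by move=> /behind_branch [].
move=> h; have := behind_edge h; case: p q h => [x|D] [y|E] h //= Dy.
  exact: vertex_acyclic h.
case: (behind_next h) => // -[[z|F] rp hr] ; first by have := behind_edge hr.
case: (behind_boundary hr (Dy : bedge (inr D) (inl y))) => [/vertex_acyclic//|[DF _]].
by apply: rp.
Qed.

Definition block_tree : tree := Tree bedge_sym bnode_connected bedge_acyclic.

(** ** The action of the automorphism group *)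

Definition bact (g : aut X) (t : bnode) : bnode :=
  match t with inl x => inl (g x) | inr D => inr (image_of_block g D) end.

Lemma bact1 t : bact 1 t = t.
Proof. by case: t => //= D; congr inr; apply: block_ext; apply: image_graph1. Qed.

Lemma bactM g h t : bact (g * h) t = bact g (bact h t).
Proof. by case: t => //= D; congr inr; apply: block_ext; apply: image_graphM. Qed.

Lemma bact_edge g p q : bedge p q -> bedge (bact g p) (bact g q).
Proof. by case: p; case: q => //= a b; rewrite /mkset iso_funK. Qed.

Lemma bact_faithful g h : bact g =1 bact h -> g = h.
Proof. by move=> gh; apply: isoP => x; have [] := gh (inl x). Qed.

Lemma bactK g : cancel (bact g) (bact g^-1).
Proof. by move=> t; rewrite -bactM mulVg bact1. Qed.

Lemma bact_inj g : injective (bact g).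
Proof. exact: can_inj (bactK g). Qed.

(** The maps between stars that an automorphism can induce if all blocks are
    transitive: isomorphisms around a block, and bijections that respect the
    isomorphism types of the blocks around a vertex. *)
Definition good t (u : bnode) (mu : bnode -> bnode) : Prop :=
  match t, u with
  | inl x, inl y =>
    [/\ forall D, sub_vertex (sval D) x -> exists E, [/\ mu (inr D) = inr E,
          sub_vertex (sval E) y & isomorphic (sval D) (sval E)],
        forall D E, sub_vertex (sval D) x -> sub_vertex (sval E) x ->
          mu (inr D) = mu (inr E) -> D = E &
        forall E, sub_vertex (sval E) y -> exists2 D, sub_vertex (sval D) x &
          mu (inr D) = inr E]
  | inr D, inr E =>
    exists th : iso (sval D) (sval E),
      forall z : sval D, mu (inl (val z)) = inl (val (th z))
  | _, _ => False
  end.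

Lemma good_act g t : good t (bact g t) (bact g).
Proof.
case: t => [x|D] /=; last first.
  by have [th thE] := image_iso g (sval D); exists th => z; rewrite thE.
split=> [D Dx|D E Dx Ex DE|E Ex].
- exists (image_of_block g D); split=> //; first by rewrite /= /mkset iso_funK.
  by have [th _] := image_iso g (sval D); split.
- by have [] : inr D = inr E :> bnode by exact: (@bact_inj g (inr D) (inr E) DE).
- exists (image_of_block g^-1 E) => //; congr inr; apply: block_ext.
  by rewrite /= -image_graphM mulgV image_graph1.
Qed.

Lemma good_star t (u : bnode) mu : good t u mu ->
  [/\ forall s, bedge t s -> bedge u (mu s),
      forall s s', bedge t s -> bedge t s' -> mu s = mu s' -> s = s' &
      forall v : bnode, bedge u v -> exists2 s, bedge t s & mu s = v].
Proof.
case: t u => [x|D] [y|E] //=.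
  move=> [muE muinj mus]; split=> [[//|D] /muE [E [-> ? _]] //|[//|D] [//|E]|[//|E]].
    by move=> Dx Ex DE; congr inr; apply: muinj.
  by move=> /mus [D Dx DE]; exists (inr D).
move=> [th thE]; have thE' z (Dz : sub_vertex (sval D) z) :
    mu (inl z) = inl (val (th (subv Dz))).
  by rewrite -thE.
split=> [[z|//] Dz|[z|//] [w|//] Dz Dw|[z|//] Ez].
- by rewrite thE'; apply: subv_val.
- rewrite !thE' => -[/val_inj /(can_inj (iso_funK th))].
  by move=> /(congr1 val) /= ->.
- pose z' : sval E := subv Ez.
  exists (inl (val (iso_inv th z'))); first exact: subv_val.
  by rewrite thE iso_invK.
Qed.

Lemma good_cover (F : bnode -> bnode) :
  (forall t, exists2 mu, good t (F t) mu & forall s, bedge t s -> F s = mu s) ->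
  exists g, bact g =1 F.
Proof.
move=> Fgood.
have Fe p q : bedge p q -> bedge (F p) (F q).
  by move=> pq; have [mu /good_star [h _ _] E] := Fgood p; rewrite (E q pq); apply: h.
have Finj p q r : bedge p q -> bedge p r -> F q = F r -> q = r.
  move=> pq pr; have [mu /good_star [_ h _] E] := Fgood p.
  by rewrite (E q pq) (E r pr); apply: h.
have Fsurj p (u : bnode) : bedge (F p) u -> exists2 q, bedge p q & F q = u.
  have [mu /good_star [_ _ h] E] := Fgood p => /h [q pq <-].
  by exists q => //; apply: E.
have [inj_F surj_F] := @tree_cover block_tree F Fe Finj Fsurj.
have Fv x : exists y, F (inl x) = inl y.
  by have [mu] := Fgood (inl x); case: (F (inl x)) => // y _ _; exists y.
have Fb D : exists E, F (inr D) = inr E.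
  by have [mu] := Fgood (inr D); case: (F (inr D)) => // E _ _; exists E.
have [f fE] := choice Fv.
have Fv' y : exists x, F (inl x) = inl y.
  have [x0 _] := cut_vertex_ex; have [[x|D] Fx] := surj_F (inl x0) (inl y).
    by exists x.
  by have [E] := Fb D; rewrite Fx.
have {Fv Fv'} [f' f'E] := choice Fv'.
have fK : cancel f f'.
  by move=> x; have [] : inl (f' (f x)) = inl x :> bnode; [apply: inj_F; rewrite f'E fE|].
have f'K : cancel f' f by move=> y; have := f'E y; rewrite fE => -[].
(* On each block, [f] is an isomorphism onto the image block. *)
have fiso D E : F (inr D) = inr E ->
    (forall x, sub_vertex (sval D) x <-> sub_vertex (sval E) (f x)) /\
    (forall x y, sub_edge (sval D) x y <-> sub_edge (sval E) (f x) (f y)).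
  move=> FD; have [mu] := Fgood (inr D); rewrite FD => -[th thE] muF.
  have thf (z : sval D) : val (th z) = f (val z).
    have := muF (inl (val z)) (subv_val z); rewrite thE fE.
    by case=> ->.
  have vE x : sub_vertex (sval D) x <-> sub_vertex (sval E) (f x).
    split=> [Dx|Ex].
      by have := Fe (inr D) (inl x) Dx; rewrite FD fE.
    have := Fsurj (inr D) (inl (f x)); rewrite FD => /(_ Ex) [[z|//] Dz].
    by rewrite fE => -[/(can_inj fK) <-].
  split=> // x y; split=> [Dxy|Exy].
    have [Dx Dy] := sub_edge_vertices Dxy.
    have := (iso_adj th (subv Dx) (subv Dy)).2 Dxy.
    by rewrite /= !thf.
  have [/vE Dx /vE Dy] := sub_edge_vertices Exy.
  apply: (iso_adj th (subv Dx) (subv Dy)).1.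
  by rewrite /= !thf.
have fadj x y : adj (f x) (f y) <-> adj x y.
  split=> [|/edge_block [D Dxy]]; last first.
    have [E FD] := Fb D; have [_ eE] := fiso D E FD.
    exact: sub_edge_adj ((eE x y).1 Dxy).
  move=> /edge_block [E Exy]; have [Ex _] := sub_edge_vertices Exy.
  have := Fsurj (inl x) (inr E); rewrite fE => /(_ Ex) [[//|D] Dx FD].
  by have [_ eE] := fiso D E FD; apply: sub_edge_adj ((eE x y).2 Exy).
exists (Iso fK f'K fadj) => -[x|D] /=; first by rewrite fE.
have [E FD] := Fb D; have [vE eE] := fiso D E FD; rewrite FD; congr inr.
apply: block_ext; apply: subgraph_ext => [x|x y] /=.
  by rewrite /mkset vE f'K.
by rewrite eE !f'K.
Qed.

Lemma bact_glue (F : block_tree -> block_tree) :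
  (forall t, exists2 g, F t = bact g t & star_eq F (bact g) t) ->
  exists g, bact g =1 F.
Proof.
move=> Fg; apply: good_cover => t; have [g -> gs] := Fg t.
by exists (bact g) => //; apply: good_act.
Qed.

Definition swap (a b c : bnode) : bnode :=
  match pselect (c = a), pselect (c = b) with
  | left _, _ => b
  | right _, left _ => a
  | right _, right _ => c
  end.

Lemma swapL a b : swap a b a = b.
Proof. by rewrite /swap; case: pselect. Qed.

Lemma swapK a b : involutive (swap a b).
Proof.
move=> c; rewrite {2}/swap; case: (pselect (c = a)) => [->|ca].
  rewrite /swap; case: (pselect (b = a)) => // ba.
  by case: (pselect (b = b)).
case: (pselect (c = b)) => [->|cb]; first exact: swapL.
by rewrite /swap; case: pselect => //; case: pselect.
Qed.

Lemma good_swap (h : aut X) x D E : sub_vertex (sval D) x -> sub_vertex (sval E) (h x) ->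
  isomorphic (sval D) (sval E) ->
  good (inl x) (inl (h x)) (swap (bact h (inr D)) (inr E) \o bact h).
Proof.
move=> Dx Ehx DE; have [hE hinj hsurj] := good_act h (inl x).
pose P (t : bnode) := if t is inr H then sub_vertex (sval H) (h x) else False.
have Psw t : P t -> P (swap (bact h (inr D)) (inr E) t).
  move=> Pt; rewrite /swap; case: pselect => [//|_]; case: pselect => // _.
  by rewrite /= /mkset iso_funK.
split=> [H Hx|H H' Hx H'x /(can_inj (swapK _ _)) /hinj|H Hx]; last first.
- have := Psw (inr H) Hx; case E' : (swap _ _ (inr H)) => [//|H'] /hsurj [K Kx hK].
  by exists K => //; rewrite /comp hK -E' swapK.
- exact.
have [H' [hH H'x isoH]] := hE H Hx; rewrite /comp hH.
have hD : isomorphic (sval D) (image_graph h (sval D)).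
  by have [th _] := image_iso h (sval D); split.
rewrite /swap; case: pselect => [E'|_].
  by exists E; split=> //; move: E'; rewrite -hH => /bact_inj [->].
case: pselect => [[H'E]|_]; last by exists H'.
exists (image_of_block h D); split=> //; first by rewrite /= /mkset iso_funK.
apply: isomorphic_trans hD; apply: isomorphic_trans (isomorphic_sym DE).
by rewrite -H'E.
Qed.

Hypothesis hT : transitive_graph X.
Hypothesis blockT : forall D, transitive_graph (sval D).

(** An automorphism carrying a vertex to its image is admissible there, and a
    swap adjusts it at one block; an isomorphism between two blocks is adjusted
    at one vertex by transitivity of the second block. *)
Lemma good_continue t (u : bnode) mu s : good t u mu -> bedge t s ->
  exists2 nu, good s (mu s) nu & nu t = u.
Proof.
case: t u => [x|D] [y|E] //=; case: s => [z|H] //.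
  move=> [muE _ _] Hx; have [E [-> Ey [th]]] := muE H Hx.
  have [a ay] := blockT (th (subv Hx)) (subv Ey).
  pose ph := iso_comp a th.
  pose nu (t : bnode) : bnode := match t with
    | inl z => match pselect (sub_vertex (sval H) z) with
               | left Hz => inl (val (ph (subv Hz))) | right _ => t end
    | inr _ => t end.
  have nuE (z : sval H) : nu (inl (val z)) = inl (val (ph z)).
    rewrite /nu; case: pselect => [Hz|]; last by case; apply: subv_val.
    by congr (inl (val (ph _))); apply: val_inj.
  exists nu; first by exists ph.
  by rewrite (nuE (subv Hx)) /ph /= ay.
move=> [th thE] Dz; rewrite (thE (subv Dz)).
have [h hz] := hT z (val (th (subv Dz))).
exists (swap (bact h (inr D)) (inr E) \o bact h); last by rewrite /= swapL.
rewrite -hz; apply: (@good_swap h z D E Dz _ (inhabits th)).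
by rewrite hz; apply: subv_val.
Qed.

Lemma star_extension o o' mu : good o o' mu ->
  exists g, bact g o = o' /\ forall s, bedge o s -> bact g s = mu s.
Proof.
move=> good0; have [F [Fo Fs Fgood]] :=
  @tree_extension block_tree good good_continue o o' mu good0.
have [g gF] := good_cover Fgood.
by exists g; split=> [|s os]; rewrite gF // Fs.
Qed.

Lemma block_extension D (a : aut (sval D)) : exists g : aut X,
  bact g (inr D) = inr D /\ forall x : sval D, g (val x) = val (a x).
Proof.
pose mu (t : bnode) : bnode := match t with
  | inl z => match pselect (sub_vertex (sval D) z) with
             | left Dz => inl (val (a (subv Dz))) | right _ => t end
  | inr _ => t end.
have muE (z : sval D) : mu (inl (val z)) = inl (val (a z)).
  rewrite /mu; case: pselect => [Dz|]; last by case; apply: subv_val.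
  by congr (inl (val (a _))); apply: val_inj.
have good0 : good (inr D) (inr D) mu by exists a.
have [g [gD gs]] := star_extension good0; exists g; split=> // x.
by have := gs (inl (val x)) (subv_val x); rewrite muE => -[].
Qed.

Lemma block_swap x D E : sub_vertex (sval D) x -> sub_vertex (sval E) x ->
  isomorphic (sval D) (sval E) -> exists g, [/\ bact g (inl x) = inl x,
    bact g (inr D) = inr E, bact g (inr E) = inr D &
    forall F, sub_vertex (sval F) x -> F <> D -> F <> E ->
      bact g (inr F) = inr F].
Proof.
move=> Dx Ex DE; have [g [gx gs]] := star_extension (@good_swap 1 x D E Dx Ex DE).
have gE F : sub_vertex (sval F) x -> bact g (inr F) = swap (inr D) (inr E) (inr F).
  by move=> Fx; rewrite (gs (inr F) Fx) /comp !bact1.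
exists g; split; rewrite ?gE ?swapL //.
  by apply: (can_inj (swapK (inr D) (inr E))); rewrite swapK swapL.
move=> F Fx FD FE; rewrite gE // /swap.
by case: pselect => [[/FD]|_] //; case: pselect => [[/FE]|_].
Qed.

End BlockTree.

(** * Sets with two elements *)

Lemma card_twoP (T : Type) (A : set T) :
  A #= `I_2 <-> exists a b, a <> b /\ A = [set a; b].
Proof.
split=> [/eq_cardSP [a Aa /eq_cardSP [b [Ab ba]]]|[a [b [ab ->]]]].
  rewrite II0 card_eq0 => /eqP A0; exists a, b; split; first by move=> E; apply: ba.
  apply/seteqP; split=> [c Ac|c [] -> //].
  have [->|ca] := pselect (c = a); first by left.
  have [->|cb] := pselect (c = b); first by right.
  by have : set0 c by rewrite -A0.
apply/eq_cardSP; exists a; first by left.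
apply/eq_cardSP; exists b; first by split; [right | exact: nesym ab].
by rewrite II0 card_eq0; apply/eqP/seteqP; split=> // c [[[E|E] ca] cb].
Qed.

Lemma lcosets_two (G : groupType) (N : set G) s : subgroup N -> ~ N s ->
  (forall g, N g \/ N (s^-1 * g)) -> lcosets N #= `I_2.
Proof.
move=> sN Ns cov; have [N1 NM NV] := (subgroupP N).1 sN; apply/card_twoP.
have coset1 g : N g -> [set g * h | h in N] = N.
  move=> Ng; apply/seteqP; split=> [_ [h Nh <-]|h Nh]; first exact: NM.
  by exists (g^-1 * h); [apply: NM => //; apply: NV | rewrite mulVKg].
exists N, [set s * h | h in N]; split.
  by move=> E; apply: Ns; rewrite E; exists 1; rewrite ?mulg1.
apply/seteqP; split=> [_ [g _ <-]|_ [->|->]]; last by exists s.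
  have [/coset1 ->|/coset1 E] := cov g; first by left.
  right; change ([set g * h | h in N] = [set s * h | h in N]).
  rewrite -[in RHS]E; apply/seteqP; split=> [_ [h Nh <-]|_ [_ [h Nh <-] <-]].
    by exists (s^-1 * g * h); [exists h | rewrite mulgA mulVKg].
  by exists h => //; rewrite mulgA mulVKg.
by exists 1 => //; apply: coset1.
Qed.

(** * Automorphism groups of graphs with connectivity one *)

Section Main.
Variable X : graph.
Hypothesis hT : transitive_graph X.
Hypothesis h1 : connectivity1 X.
Implicit Types (x y z : X) (D E F : block X) (g h m : aut X).
Local Notation T := (block_tree h1).
Local Notation act := (@bact X : aut X -> T -> T).
Local Notation incident D x := (sub_vertex (sval D) x).

Lemma block_restrict g D : bact g (inr D) = inr D ->
  exists a : aut (sval D), forall x : sval D, val (a x) = g (val x).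
Proof.
move=> gD; have := good_act g (inr D); rewrite gD => -[th thE].
by exists th => x; have [] := thE x.
Qed.

Lemma three_vertices : exists x y z, [/\ y <> x, z <> x & y <> z].
Proof.
have [x [y [z [yx zx nyz]]]] := cut_vertex_ex h1; exists x, y, z; split=> // yz.
by apply: nyz; rewrite yz; apply: rt_refl.
Qed.

(** Two vertices of a block [B] in different orbits of its automorphism group
    give flags in different orbits of the group.  The indicator of one of
    these orbits of flags is an invariant weight on the tree, and an
    automorphism taking one vertex to the other is not in its kernel. *)
Lemma nontransitive_block (B : subgraph X) : is_block B -> ~ transitive_graph B ->
  ~ simple [set: aut X].
Proof.
move=> bB nB [_ _ simpleG]; pose D : block X := exist _ B bB.
have [x /existsNP [y nxy]] : exists x : B, ~ forall y : B, exists g : aut B, g x = y.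
  exact/existsNP.
pose w (s t : bnode X) := `[< exists g,
  (bact g (inl (val x)) = s /\ bact g (inr D) = t) \/
  (bact g (inl (val x)) = t /\ bact g (inr D) = s) >].
have wsym s t : w s t = w t s.
  by apply: asbool_equiv_eq; split=> -[g h]; exists g; apply/or_comm.
have winv g s t : w (bact g s) (bact g t) = w s t.
  apply: asbool_equiv_eq; split=> -[h H].
    exists (g^-1 * h); rewrite !bactM.
    by case: H => -[-> ->]; rewrite !bactK; [left | right].
  by exists (g * h); rewrite !bactM; case: H => -[-> ->]; [left | right].
have [N [normN NM Nw]] := @weight_kernel T _ act (@bact1 X) (@bactM X)
  (@bact_edge X) w wsym winv.
have [h hxy] := hT (val x) (val y).
have nNh : ~ N h.
  move=> Nh; have := Nw h (inl (val x)) (inr D) Nh (subv_val x).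
  rewrite /= hxy => /(_ (subv_val y)).
  have -> : w (inl (val x)) (inr D) by apply/asboolP; exists 1; left; rewrite !bact1.
  move=> /esym /asboolP [g [[[gxy] gD]|[//]]].
  have [a aE] := block_restrict gD; apply: nxy; exists a.
  by apply: val_inj; rewrite aE.
have [N1|NT] := simpleG N normN; last by apply: nNh; rewrite NT.
have [c [u [v [uc vc uv]]]] := three_vertices.
have [a au] := hT c u; have [b bv] := hT c v.
have nN g z : g c = z -> z <> c -> ~ N g.
  by move=> gz zc; rewrite N1 => g1; apply: zc; rewrite -gz g1.
have nNa := nN _ _ au uc; have nNb := nN _ _ bv vc.
have aa := NM _ _ nNa nNa; have ba := NM _ _ nNb nNa.
apply: uv; rewrite -au -bv; congr (iso_fun _ c).
by move: aa ba; rewrite N1 /= => aa ba; apply: (@mulIg _ a); rewrite /= aa ba.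
Qed.

(** Every vertex is a cut vertex, but a vertex in a single block is not: all
    its neighbors lie in that block and remain joined within it. *)
Lemma two_blocks x D : incident D x -> exists2 E, incident E x & E <> D.
Proof.
move=> Dx; apply: contrapT => no2.
have one E : incident E x -> E = D.
  by move=> Ex; apply: contrapT => ED; apply: no2; exists E.
have [c [u [v [uc vc nuv]]]] := cut_vertex_ex h1; have [g gc] := hT c x.
have to_nbr z : z <> x -> exists a, adj a x /\ clos_refl_trans X (avoid (@adj X) x) z a.
  have := clos_rt_rt1n _ _ _ _ (h1.1 z x); elim=> {z} [z //|z a y za _ IH zy].
  have [ay|ay] := pselect (a = y).
    by exists z; rewrite -ay; split=> //; apply: rt_refl.
  have [b [by_ ab]] := IH ay; exists b; split=> //.
  by apply: rt_trans (rt_step _ _ _ _ _) ab.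
have gne z : z <> c -> g z <> x by rewrite -gc => zc /(can_inj (iso_funK g)).
have [a [ax ua]] := to_nbr _ (gne _ uc); have [b [bx vb]] := to_nbr _ (gne _ vc).
have inD z : adj z x -> incident D z /\ z <> x.
  move=> zx; have [E /sub_edge_vertices [Ez Ex]] := edge_block zx.
  by rewrite -(one E Ex); split=> // E'; apply: (@adj_irr X x); rewrite -{1}E'.
have [Da nax] := inD _ ax; have [Db nbx] := inD _ bx.
have [[_ nD] _] := (is_blockP _).1 (svalP D).
have ab : clos_refl_trans X (avoid (@adj X) x) a b.
  apply: (@walk_sub X X id) (nD x _ _ Da Db nax nbx) => p q [pq px qx].
  by split=> //; apply: sub_edge_adj pq.
have guv : clos_refl_trans X (avoid (@adj X) x) (g u) (g v).
  apply: rt_trans ua (rt_trans _ _ _ _ _ ab _); apply: walk_sym vb => p q.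
  by apply: avoid_sym; apply: adj_sym.
apply: nuv; rewrite -(iso_funK g u) -(iso_funK g v).
apply: (walk_sub _ guv) => p q [pq px qx]; split; first exact/aut_inv_adj.
  by move=> pc; apply: px; rewrite -gc -pc iso_invK.
by move=> qc; apply: qx; rewrite -gc -qc iso_invK.
Qed.

(** ** Blocks generated by vertex stabilizers *)

Hypothesis blockT : forall D, transitive_graph (sval D).
Hypothesis blockG : forall D, generated_by_stabilizers (sval D).

Definition flag_group : set (aut X) := generated (edge_fixator act).
Local Notation M := flag_group.

Let sgM : subgroup M. Proof. exact: subgroup_generated. Qed.
Let M1 : M 1. Proof. by case/subgroupP: sgM. Qed.
Let MM g h : M g -> M h -> M (g * h). Proof. by case/subgroupP: sgM => _ + _; apply. Qed.
Let MV g : M g -> M g^-1. Proof. by case/subgroupP: sgM => _ _; apply. Qed.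

Lemma edge_fixator_flag_group : edge_fixator act `<=` M.
Proof. exact: sub_gen_smallest. Qed.

Lemma flag_fixator g x D : incident D x -> bact g (inl x) = inl x ->
  bact g (inr D) = inr D -> M g.
Proof. by move=> Dx gx gD; apply: edge_fixator_flag_group; exists (inl x, inr D). Qed.

Lemma flag_group_normal : normal_in M [set: aut X].
Proof.
split=> // m h + _; pose A := [set m | forall h, M (m ^ h)].
suff : M `<=` A by move=> /[apply].
apply: smallest_sub.
  apply/subgroupP; split=> [g|a b Aa Ab g|a Aa g]; first by rewrite conj1g.
    by rewrite conjMg; apply: MM.
  by rewrite conjVg; apply: MV.
move=> k [[p q] /= pq [kp kq]] g; apply: edge_fixator_flag_group.
exists (bact g^-1 p, bact g^-1 q) => /=; first exact: bact_edge.
have gV t : bact g (bact g^-1 t) = t by rewrite -bactM mulgV bact1.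
by rewrite conjgE !bactM !gV kp kq.
Qed.

(** The automorphisms of a block that are induced by [M] form a group containing
    all vertex stabilizers, and the kernel of the restriction fixes flags. *)
Lemma block_stabilizer g D : bact g (inr D) = inr D -> M g.
Proof.
move=> gD; have [a aE] := block_restrict gD.
pose A := [set a : aut (sval D) | exists2 m, M m & bact m (inr D) = inr D /\
  forall x : sval D, m (val x) = val (a x)].
have : generated (\bigcup_(x in [set: sval D]) stabilizer x) `<=` A.
  apply: smallest_sub; first apply/subgroupP; first split.
  - by exists 1 => //; rewrite bact1.
  - move=> b c [m Mm [mD mb]] [n Mn [nD nc]]; exists (m * n); first exact: MM.
    by split=> [|x]; [rewrite bactM nD | rewrite /= nc mb].
  - move=> b [m Mm [mD mb]]; exists m^-1; first exact: MV.
    split=> [|x]; first by rewrite -{1}mD bactK.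
    by rewrite /= -{1}(iso_invK b x) -mb iso_funK.
  move=> b [x _ bx]; have [h [hD hb]] := block_extension h1 hT blockT b.
  exists h => //; apply: (flag_fixator (subv_val x)) => //=.
  by rewrite hb bx.
rewrite blockG => /(_ a I) [m Mm [mD ma]].
have [x [_ [Dx _ _]]] := block_two h1 D.
rewrite -(mulVKg m g); apply: MM => //.
apply: (flag_fixator Dx); rewrite bactM; last by rewrite gD -{1}mD bactK.
have gm : g x = m x by have := aE (subv Dx); rewrite -ma.
by rewrite -[RHS](bactK m) /= gm.
Qed.

Let color (t : T) : bool := if t is inl _ then true else false.

Lemma color_edge p q : edge (t := T) p q -> color p = ~~ color q.
Proof. by case: p; case: q. Qed.

Lemma color_act g p : color (act g p) = color p.
Proof. by case: p. Qed.

Lemma flag_group_block_trans (D x y : T) : ~~ color D -> edge D x -> edge D y ->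
  exists2 m, M m & act m D = D /\ act m x = y.
Proof.
case: D x y => [//|D] [x|//] [y|//] _ Dx Dy.
have [a axy] := blockT (subv Dx) (subv Dy).
have [g [gD ga]] := block_extension h1 hT blockT a.
exists g; first exact: block_stabilizer gD.
by split=> //=; rewrite (ga (subv Dx)) axy.
Qed.

(** In a block with only two vertices the vertex stabilizers would be trivial,
    and could not generate a transitive group. *)
Lemma block_deg (D x : T) : ~~ color D -> edge D x ->
  exists y z : T, [/\ edge D y, edge D z, y <> x, z <> x & y <> z].
Proof.
case: D x => [//|D] [x|//] _ Dx.
have [y [Dy yx]] : exists y : X, incident D y /\ y <> x.
  have [u [v [Du Dv uv]]] := block_two h1 D.
  have [ux|ux] := pselect (u = x); last by exists u.
  by exists v; split=> // vx; apply: uv; rewrite ux.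
apply: contrapT => no3.
have only z : incident D z -> z = x \/ z = y.
  move=> Dz; apply: contrapT => nz; apply: no3; exists (inl y), (inl z).
  by split=> // -[E]; apply: nz; [left | left | right].
have : generated (\bigcup_(u in [set: sval D]) stabilizer u) `<=` [set 1].
  apply: smallest_sub.
    apply/subgroupP; split=> [//|a b -> ->|a ->]; first by rewrite /= mulg1.
    by rewrite /= invg1.
  move=> a [u _ /= au]; apply: isoP => v /=.
  have [->//|vu] := pselect (v = u).
  have avu : a v <> u by move=> E; apply: vu; apply: (can_inj (iso_funK a)); rewrite E.
  have vvu : val v <> val u by move=> /val_inj.
  have vavu : val (a v) <> val u by move=> /val_inj.
  apply: val_inj; move: vvu vavu.
  by case: (only _ (subv_val u)) => ->; case: (only _ (subv_val v)) => ->;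
     case: (only _ (subv_val (a v))) => ->.
rewrite blockG => triv; have [a axy] := blockT (subv Dx) (subv Dy).
have := triv a I => /= a1; apply: yx.
by have := congr1 val axy; rewrite a1.
Qed.

Lemma vertex_deg (x D : T) : color x -> edge x D ->
  exists2 F : T, edge x F & F <> D.
Proof.
case: x D => [x|//] [//|D] _ Dx; have [E Ex ED] := two_blocks Dx.
by exists (inr E) => // -[].
Qed.

Lemma flag_group_trans x y : exists2 m, M m & m x = y.
Proof.
have [m Mm [mx]] := @vertex_trans T _ act (@bact1 X) (@bactM X) color color_edge
  M sgM flag_group_block_trans (inl x) (inl y) isT isT.
by exists m.
Qed.

Lemma flag_group_simple : simple M.
Proof.
split=> // [M1E|K [sgK KM normK]].
  have [x [y [_ [yx _ _]]]] := three_vertices.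
  have [m Mm mx] := flag_group_trans x y.
  by apply: yx; rewrite -mx; move: Mm; rewrite M1E => ->.
have [[k [Kk k1]]|nk] := pselect (exists k, K k /\ k <> 1); last first.
  left; apply/seteqP; split=> [k Kk|_ ->]; last by case/subgroupP: sgK.
  by apply: contrapT => k1; apply: nk; exists k.
right; apply/seteqP; split=> //; apply: smallest_sub => //.
exact: (@edge_fixator_sub_normal T _ act (@bact1 X) (@bactM X) (@bact_edge X)
  (@bact_faithful X) (@bact_glue X h1) color color_edge color_act M K sgK sgM
  edge_fixator_flag_group normK flag_group_block_trans block_deg vertex_deg k).
Qed.

(** An automorphism fixing [x] and moving a block [D] at [x] can be corrected
    by a swap of [D] with its image, which lies in [M] as soon as there is a
    third block at [x] to be left fixed. *)
Lemma flag_group_full x :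
  ~ (blocks_at x #= `I_2 /\
     forall B C : subgraph X, is_block B -> is_block C -> isomorphic B C) ->
  M = [set: aut X].
Proof.
move=> nexc; apply/seteqP; split=> // g _.
have [m Mm mgx] := flag_group_trans (g x) x.
suff Mmg : M (m * g) by rewrite -(mulKg m g); apply: MM => //; apply: MV.
have hx : (m * g) x = x by [].
move: (m * g) hx => {m Mm mgx} {}g gx.
have [a xa] := neighbor_ex h1 x.
have [D /sub_edge_vertices [Dx _]] := edge_block xa.
have [gD|gD] := pselect (bact g (inr D) = inr D); first exact: block_stabilizer gD.
pose E := image_of_block g D.
have Ex : incident E x by rewrite /= /mkset -[in iso_inv g x]gx iso_funK.
have iso_image h (B : subgraph X) : isomorphic B (image_graph h B).
  by have [th _] := image_iso h B; split.
have [[F [Fx FD FE]]|no3] := pselect (exists F, [/\ incident F x, F <> D & F <> E]).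
  have [t [tx tD tE tF]] := block_swap h1 hT blockT Dx Ex (iso_image g (sval D)).
  have Mt : M t by apply: flag_fixator Fx tx (tF _ Fx FD FE).
  rewrite -(mulKg t g); apply: MM; first exact: MV.
  by apply: (@block_stabilizer _ D); rewrite bactM tE.
have DE F : incident F x -> F = D \/ F = E.
  by move=> Fx; apply: contrapT => nF; apply: no3; exists F; split=> // FE;
     apply: nF; [left | right].
case: nexc; split.
  apply/card_twoP; exists (sval D), (sval E); split.
    by move=> /block_ext DE'; apply: gD; rewrite /= -/E -DE'.
  apply/seteqP; split=> [B [bB Bx]|_ [->|->]]; last 2 first.
  - by split=> //; apply: svalP.
  - by split=> //; apply: svalP.
  by have [/(congr1 sval)|/(congr1 sval)] := DE (exist _ B bB) Bx => /= ->; [left|right].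
have isoD (B : subgraph X) : is_block B -> isomorphic B (sval D).
  move=> bB; pose B' : block X := exist _ B bB.
  have [y [_ [By _ _]]] := block_two h1 B'; have [h hy] := hT y x.
  have hBx : incident (image_of_block h B') x by rewrite /= /mkset -hy iso_funK.
  apply: isomorphic_trans (iso_image h B) _.
  have [/(congr1 sval)|/(congr1 sval)] := DE _ hBx => /= ->.
    by split; apply: aut_id.
  exact: isomorphic_sym.
move=> B C bB bC; apply: isomorphic_trans (isoD B bB) _.
exact/isomorphic_sym/isoD.
Qed.

(** Select one of the two blocks at every vertex.  A potential for the indicator
    of the selected flags colors the blocks with two colors, differently at
    every vertex.  An element that preserves the color of one block preserves
    those of its neighbors and so of all blocks; hence flag stabilizers preserve
    the coloring, and [g] does not. *)
Lemma swap_notin x g D E : blocks_at x #= `I_2 -> incident D x -> incident E x ->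
  D <> E -> bact g (inr D) = inr E -> ~ M g.
Proof.
move=> /card_twoP [B [C [_ BC]]] Dx Ex DE gDE Mg.
have two y (D1 E1 F1 : block X) : incident D1 y -> incident E1 y -> incident F1 y ->
    D1 <> E1 -> F1 = D1 \/ F1 = E1.
  have [h hy] := hT y x => D1y E1y F1y.
  have at_x F2 : incident F2 y ->
      image_graph h (sval F2) = B \/ image_graph h (sval F2) = C.
    move=> F2y; have : blocks_at x (image_graph h (sval F2)).
      split; first by apply: image_block; apply: svalP.
      by rewrite /= /mkset -hy iso_funK.
    by rewrite BC.
  have inj F2 F3 : image_graph h (sval F2) = image_graph h (sval F3) -> F2 = F3.
    move=> /(congr1 (image_graph h^-1)); rewrite !image_graphK; exact: block_ext.
  move=> ne; case: (at_x _ D1y) => e1; case: (at_x _ E1y) => e2;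
    case: (at_x _ F1y) => e3.
  - by case: ne; apply: inj; rewrite e1.
  - by case: ne; apply: inj; rewrite e1.
  - by left; apply: inj; rewrite e1.
  - by right; apply: inj; rewrite e2.
  - by right; apply: inj; rewrite e2.
  - by left; apply: inj; rewrite e1.
  - by case: ne; apply: inj; rewrite e1.
  - by case: ne; apply: inj; rewrite e1.
have [d dP] := @choice X (block X) (fun y F => incident F y)
  (fun y => let: ex_intro a ya := neighbor_ex h1 y in
            let: ex_intro F Fya := edge_block ya in
            ex_intro _ F (sub_edge_vertices Fya).1).
pose w (s t : bnode X) := `[< exists y, (s = inl y /\ t = inr (d y)) \/
                                        (t = inl y /\ s = inr (d y)) >].
have [P Pw] := @potential T w (fun s t => asbool_equiv_eq
  (conj (fun '(ex_intro y h) => ex_intro _ y ((or_comm _ _).1 h))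
        (fun '(ex_intro y h) => ex_intro _ y ((or_comm _ _).1 h)))).
have Pneq y (D1 E1 : block X) : incident D1 y -> incident E1 y -> D1 <> E1 ->
    P (inr E1) = ~~ P (inr D1).
  move=> Dy Ey ne; have wE F : w (inl y) (inr F) = `[< F = d y >].
    apply: asbool_equiv_eq; split=> [[z [[[->] [->]]|[//]]] //|->].
    by exists y; left.
  have := Pw (inl y) (inr D1) Dy; have := Pw (inl y) (inr E1) Ey; rewrite !wE.
  have [dD|dE] := two y _ _ _ Dy Ey (dP y) ne.
    rewrite dD; have -> : `[< D1 = D1 >] by apply/asboolP.
    have -> : `[< E1 = D1 >] = false by apply/asboolPn => E'; apply: ne.
    by case: (P (inl y)); case: (P (inr D1)); case: (P (inr E1)).
  rewrite dE; have -> : `[< E1 = E1 >] by apply/asboolP.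
  have -> : `[< D1 = E1 >] = false by apply/asboolPn.
  by case: (P (inl y)); case: (P (inr D1)); case: (P (inr E1)).
pose N := [set h : aut X | forall F, P (bact h (inr F)) = P (inr F)].
have sgN : subgroup N.
  apply/subgroupP; split=> [F|a b Na Nb F|a Na F]; first by rewrite bact1.
    by rewrite bactM; exact: etrans (Na (image_of_block b F)) (Nb F).
  have aV : bact a (bact a^-1 (inr F)) = inr F by rewrite -bactM mulgV bact1.
  exact: esym (etrans (congr1 P (esym aV)) (Na (image_of_block a^-1 F))).
suff MN : M `<=` N by have := MN _ Mg D; rewrite gDE (Pneq x D E) //; case: (P _).
apply: smallest_sub => // h hfix.
have [F0 hF0] : exists F, bact h (inr F) = inr F.
  by case: hfix => -[[y|F] [z|H]] //= _ [hp hq]; [exists H | exists F].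
pose Q (t : T) := match t with
  | inl y => forall F, incident F y -> P (bact h (inr F)) = P (inr F)
  | inr F => P (bact h (inr F)) = P (inr F) end.
move=> F; suff : Q (inr F) by [].
apply: (@walk_ind T _ Q (inr F0) _ _ (edge_connected _ _)); last by rewrite /Q hF0.
move=> [y|E1] [z|F1] //= yF1; first by apply.
move=> PE1 F1 zF1; have [->//|ne] := pselect (F1 = E1).
have hz E2 : incident E2 z -> incident (image_of_block h E2) (h z).
  by rewrite /= /mkset iso_funK.
rewrite (Pneq z E1 F1) //; last exact: nesym.
have ne' : image_of_block h E1 <> image_of_block h F1.
  move=> /(congr1 (@inr X (block X))) /(@bact_inj X h (inr E1) (inr F1)).
  by case=> /esym.
by rewrite (Pneq (h z) (image_of_block h E1) (image_of_block h F1)) ?PE1 //; apply: hz.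
Qed.

Lemma flag_group_index2 x : blocks_at x #= `I_2 ->
  (forall B C : subgraph X, is_block B -> is_block C -> isomorphic B C) ->
  lcosets M #= `I_2.
Proof.
move=> card2 isoBC; have [B [C [BC BCx]]] := (card_twoP _).1 card2.
have [bB Bx] : blocks_at x B by rewrite BCx; left.
have [bC Cx] : blocks_at x C by rewrite BCx; right.
pose D : block X := exist _ B bB; pose E : block X := exist _ C bC.
have DE : D <> E by move=> /(congr1 sval).
have [s [sx sD sE _]] := block_swap h1 hT blockT
  (Bx : incident D x) (Cx : incident E x) (isoBC _ _ bB bC).
apply: (@lcosets_two _ _ s) => //; first exact: (@swap_notin x _ D E).
move=> g; have [m Mm mgx] := flag_group_trans (g x) x.
have : blocks_at x (image_graph (m * g) B).
  split; first exact: image_block.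
  by rewrite /= /mkset -{1}mgx !iso_funK.
rewrite BCx => -[mgB|mgC].
  left; rewrite -(mulKg m g); apply: MM; first exact: MV.
  by apply: (@block_stabilizer _ D); congr inr; apply: block_ext.
right; have -> : s^-1 * g = (m^-1) ^ s * (s^-1 * (m * g)).
  by rewrite conjgE !mulgA mulgK mulgVK.
apply: MM; first by case: flag_group_normal => _ _; apply=> //; apply: MV.
apply: (@block_stabilizer _ D); rewrite bactM.
have -> : bact (m * g) (inr D) = inr E by congr inr; apply: block_ext.
by rewrite -sD bactK.
Qed.

End Main.


Theorem theorem13 (X : graph) (hT : transitive_graph X)
    (h1 : connectivity1 X) (x : X) :
  (forall y : X, blocks_at y #= blocks_at x) /\
  ((exists2 B : subgraph X, is_block B & ~ transitive_graph B) ->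
     ~ simple [set: aut X]) /\
  ((forall B : subgraph X, is_block B ->
      transitive_graph B /\ generated_by_stabilizers B) ->
   let exceptional :=
     blocks_at x #= `I_2 /\
     forall B C : subgraph X, is_block B -> is_block C -> isomorphic B C in
   (~ exceptional -> simple [set: aut X]) /\
   (exceptional -> exists N : set (aut X),
      [/\ normal_in N [set: aut X], simple N & lcosets N #= `I_2])).
Proof.
split=> [y|]; first by have [g <-] := hT x y; apply: blocks_at_card.
split=> [[B]|hB]; first exact: nontransitive_block.
have blockT (D : block X) : transitive_graph (sval D) by case: (hB _ (svalP D)).
have blockG (D : block X) : generated_by_stabilizers (sval D) by case: (hB _ (svalP D)).
split=> [nexc|[card2 isoBC]].
  rewrite -(flag_group_full hT h1 blockT blockG nexc).
  exact: flag_group_simple.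
exists (flag_group h1); split; first exact: flag_group_normal.
  exact: flag_group_simple.
exact: flag_group_index2 card2 isoBC.
Qed.
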